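(* Let $n\ge3$, let $v\in h^\infty(\mathbb{R}^n_+)$ and let $x$ be an arbitrary point in $\mathbb{R}^n_+$. Let $\alpha_n$ be the root from the interval $(1,+\infty)$ of the equation $$\frac{2}{\pi(n\alpha-1)}=\frac{\alpha-1}{1+\sqrt{1+(\alpha-1)^2}}$$ with respect to $\alpha$. If $\alpha\ge\alpha_n$, then the sharp coefficient $\mathcal{C}_{\alpha,n,\infty}(x)$ in the inequality $$\left|\nabla\big(x_n^{n\alpha-1}v(x)\big)\right|\le\mathcal{C}_{\alpha,n,\infty}(x)\,\|v\|_\infty$$ is given by $$\mathcal{C}_{\alpha,n,\infty}(x)=(n\alpha-1)\,x_n^{\,n\alpha-2}.$$ Under these conditions, the absolute value of the derivative of $x_n^{n\alpha-1}v$ with respect to the normal to the boundary of the half-space at any $x\in\mathbb{R}^n_+$ has the same supremum as $|\nabla(x_n^{n\alpha-1}v)|$.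
   Context: $\mathbb{R}^n_+=\{x=(x',x_n):x'\in\mathbb{R}^{n-1},\ x_n>0\}$; $\omega_n=2\pi^{n/2}/\Gamma(n/2)$. $h^\infty(\mathbb{R}^n_+)$ is the space of (real) harmonic functions on $\mathbb{R}^n_+$ representable as the Poisson integral $v(x)=\frac{2}{\omega_n}\int_{\mathbb{R}^{n-1}}\frac{x_n}{|y-x|^n}v(y')\,dy'$, $y=(y',0)$, with boundary values $v(y')$ in $L^\infty(\mathbb{R}^{n-1})$; $\|v\|_\infty$ is the $L^\infty(\mathbb{R}^{n-1})$-norm of the boundary values. ''Sharp coefficient'' at a given $x$ means the smallest one for which the inequality holds for all $v\in h^\infty(\mathbb{R}^n_+)$. The derivative with respect to the normal is $\partial/\partial x_n$; the suprema in the last sentence are over all $v\in h^\infty(\mathbb{R}^n_+)$ with $\|v\|_\infty\le1$. *)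

(* Defs.v *)
From HB Require Import structures.
From mathcomp Require Import all_boot all_order all_algebra.
From mathcomp Require Import all_classical all_reals all_analysis.
Import Order.TTheory GRing.Theory Num.Theory.
Import numFieldNormedType.Exports.

Set Implicit Arguments.
Unset Strict Implicit.
Unset Printing Implicit Defensive.

Local Open Scope classical_set_scope.
Local Open Scope ring_scope.

(* Throughout, R^n is 'rV[R]_n with n = m.+1, the normal direction being the
   last coordinate (index ord_max).  The boundary R^(n-1) carries a measure and
   no calculus, hence is represented by m-tuples, for which the library provides
   the product sigma-algebra. *)

Definition tuple_cons (R : realType) (m : nat)
    (p : measurableTypeR R * m.-tuple (measurableTypeR R)) :
  m.+1.-tuple (measurableTypeR R) := [tuple of p.1 :: p.2].

Lemma measurable_tuple_cons (R : realType) (m : nat) :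
  measurable_fun [set: measurableTypeR R * m.-tuple (measurableTypeR R)]
    (@tuple_cons R m).
Proof. exact: measurable_cons measurable_fst measurable_snd. Qed.

Section lebesgue_cons.
Variables (R : realType) (m : nat).
Variable mu : {measure set (m.-tuple (measurableTypeR R)) -> \bar R}.

Let mtuple_cons := @measurable_tuple_cons R m.

Definition lebesgue_cons : set (m.+1.-tuple (measurableTypeR R)) -> \bar R :=
  pushforward (@lebesgue_measure R \x^ mu)%E (@tuple_cons R m).

Let lebesgue_cons0 : lebesgue_cons set0 = 0%E.
Proof. exact: measure0. Qed.

Let lebesgue_cons_ge0 A : (0 <= lebesgue_cons A)%E.
Proof. exact: measure_ge0. Qed.

Let lebesgue_cons_sigma_additive : semi_sigma_additive lebesgue_cons.
Proof. exact: measure_semi_sigma_additive. Qed.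

HB.instance Definition _ := isMeasure.Build _ _ _ lebesgue_cons
  lebesgue_cons0 lebesgue_cons_ge0 lebesgue_cons_sigma_additive.

End lebesgue_cons.

(* Lebesgue measure on R^m, as an iterated product. *)
Fixpoint lebesgue_tuple (R : realType) (m : nat) :
    {measure set (m.-tuple (measurableTypeR R)) -> \bar R} :=
  match m with
  | 0 => dirac [tuple]
  | k.+1 => lebesgue_cons (lebesgue_tuple R k)
  end.

(* The recursion above yields the volume of boxes. *)
Lemma lebesgue_tuple_box (R : realType) (m : nat)
    (A : 'I_m -> set (measurableTypeR R)) :
  (forall i, measurable (A i)) ->
  lebesgue_tuple R m [set y | forall i, A i (tnth y i)] =
  (\prod_(i < m) (@lebesgue_measure R (A i)))%E.
Proof.
elim: m A => [|m IH] A mA.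
  rewrite big_ord0 /= diracE mem_set//.
  by case.
rewrite big_ord_recl -IH //= -product_measure2E //; last first.
  rewrite (_ : mkset _ = \bigcap_(i in [set: 'I_m])
    ((fun y : m.-tuple (measurableTypeR R) => tnth y i) @^-1` A (lift ord0 i))).
    apply: fin_bigcap_measurable => // i _.
    by rewrite -[X in measurable X]setTI; exact: measurable_tnth.
  by apply/seteqP; split => y /= h i; [move=> _|]; exact: h.
rewrite /lebesgue_cons /pushforward; congr (_ _); apply/seteqP; split => -[t y] /=.
- move=> h; split=> /=; first exact: (h ord0).
  by move=> i; have := h (lift ord0 i); rewrite tnthS.
- move=> [h0 h] i; case: (unliftP ord0 i) => [j ->|->] //=.
  by rewrite tnthS; exact: h.
Qed.

Section half_space.
Variables (R : realType) (m : nat).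
Implicit Types (x : 'rV[R]_m.+1) (u : 'rV[R]_m.+1 -> R)
  (f : m.-tuple (measurableTypeR R) -> R) (a C : R).

Definition half_space : set 'rV[R]_m.+1 := [set x | 0 < x 0 ord_max].

(* The norm of the normed space 'rV[R]_n is the sup-norm. *)
Definition enorm x : R := Num.sqrt (\sum_(i < m.+1) x 0 i ^+ 2).

Definition partial (i : 'I_m.+1) u x : R := 'D_(delta_mx 0 i) u x.

Definition gradient u x : 'rV[R]_m.+1 := \row_i partial i u x.

Definition harmonic_on (U : set 'rV[R]_m.+1) u : Prop :=
  [/\ forall x, U x -> {for x, continuous u},
      forall x i, U x -> derivable u x (delta_mx 0 i) /\
        {for x, continuous (partial i u)},
      forall x i j, U x -> derivable (partial i u) x (delta_mx 0 j) /\
        {for x, continuous (partial j (partial i u))}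
    & forall x, U x -> \sum_(i < m.+1) partial i (partial i u) x = 0].

Definition boundary_point (y : m.-tuple (measurableTypeR R)) : 'rV[R]_m.+1 :=
  \row_i if unlift ord_max i is Some j then tnth y j else 0.

Definition Gamma (s : R) : R :=
  \int[@lebesgue_measure R]_(t in `]0, +oo[) (t `^ (s - 1) * expR (- t)).

(* The area 2 pi^(n/2) / Gamma(n/2) of the unit sphere of R^n. *)
Definition sphere_area (n : nat) : R :=
  2 * pi `^ (n%:R / 2) / Gamma (n%:R / 2).

Definition poisson f x : R :=
  2 / sphere_area m.+1 *
  \int[lebesgue_tuple R m]_y
    (x 0 ord_max / enorm (boundary_point y - x) ^+ m.+1 * f y).

(* u belongs to h^oo of the half-space, with boundary values f.  The values of u
   outside the open half-space are irrelevant. *)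
Definition hardy_infty u f : Prop :=
  [/\ harmonic_on half_space u,
      f \in Lfun (lebesgue_tuple R m) +oo%E
    & forall x, half_space x -> u x = poisson f x].

Definition Linfty_norm f : R := fine ('N[lebesgue_tuple R m]_+oo [EFin \o f])%E.

Definition weighted a u : 'rV[R]_m.+1 -> R :=
  fun y => y 0 ord_max `^ (m.+1%:R * a - 1) * u y.

Definition gradient_bound a x C : Prop :=
  forall u f, hardy_infty u f ->
    enorm (gradient (weighted a u) x) <= C * Linfty_norm f.

Definition sharp_coefficient a x C : Prop :=
  gradient_bound a x C /\ forall C', gradient_bound a x C' -> C <= C'.

Definition sup_gradient a x : \bar R :=
  ereal_sup [set z | exists u f, [/\ hardy_infty u f, Linfty_norm f <= 1 &
    z = (enorm (gradient (weighted a u) x))%:E]].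

Definition sup_normal a x : \bar R :=
  ereal_sup [set z | exists u f, [/\ hardy_infty u f, Linfty_norm f <= 1 &
    z = `|partial ord_max (weighted a u) x|%:E]].

End half_space.

Definition alpha_root (R : realType) (n : nat) (a : R) : Prop :=
  1 < a /\
  2 / (pi * (n%:R * a - 1)) = (a - 1) / (1 + Num.sqrt (1 + (a - 1) ^+ 2)).

(* Main.v *)
Require Import Defs.
From HB Require Import structures.
From mathcomp Require Import all_boot all_order all_algebra.
From mathcomp Require Import all_classical all_reals all_analysis.
From mathcomp Require Import measurable_realfun ess_sup_inf ring lra.
Import Order.TTheory GRing.Theory Num.Theory.
Import numFieldNormedType.Exports.
Local Open Scope classical_set_scope.
Local Open Scope ring_scope.

(** Why the theorem holds.  Write [n = m.+1], [t = alpha - 1], and let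
    [e = (y - x) / |y - x|] be the direction from [x] to the boundary point
    [y].  The Poisson kernel [k] at [x] has mass [1], and differentiating the
    Poisson integral of [f] under the integral sign gives, for a vector [z],

      z . grad (x_n^(n alpha - 1) u) (x)
        = x_n^(n alpha - 2) n * int k (alpha z_n - e_n (e . z)) f.

    By duality the gradient estimate reduces to an inequality about [k] alone
    ([mean_weight_le]): for [|z| <= 1],

      int k |alpha z_n - e_n (e . z)| <= alpha - 1/n.

    For [z] the normal vector the weight [alpha - e_n^2] is positive and there is
    equality, because [int k e_n^2 = 1/n].  The function [u = 1], with boundary
    values [1], therefore attains the bound, and its gradient is normal: this is
    both the sharpness and the equality of the two suprema.

    For a general [z], with [c = z_n >= 0] and tangential part [w] of norm [s],
    the weight is [c A + B] with [A = alpha - e_n^2 >= t] and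
    [B = - e_n (e . w)], [|B| <= s / 2].  When [s <= 2 t c] it is nonnegative and
    integrates to [c (alpha - 1/n)].  Otherwise a fraction [2 t c / s] of [B] is
    still absorbed by the sign of [c A], and only the remaining fraction is
    estimated by its absolute value ([norm_majorant]).  The moments needed are
    [int k B = 0] and [int k B^2 = s^2 / (n (n + 2))].  They come
    from the mass of [k], which does not depend on [x]: its first and second
    derivatives, taken under the integral sign, vanish, and this is what the
    identities say.  What remains is the numerical
    inequality [cap_inequality], for which [1 <= t (n alpha - 1)] suffices; the
    equation of [alpha_n] gives [4 / pi <= t (n alpha - 1)]
    ([alpha_root_le]).

    The mass of the kernel ([poisson_kernel_mass]) comes from writing
    [|y - x|^(-n)] as a mixture of the Gaussians [exp (- r |y - x|^2)], which
    Tonelli's theorem integrates coordinate by coordinate. *)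

Set Implicit Arguments.
Unset Strict Implicit.
Unset Printing Implicit Defensive.

(** * Tonelli on the space of tuples *)

Section measurable_real.
Context d (Y : measurableType d) (R : realType).
Implicit Types (D : set Y) (f : Y -> R).

Lemma measurable_fun_sqrt D f : measurable_fun D f ->
  measurable_fun D (fun y => Num.sqrt (f y)).
Proof.
apply: measurableT_comp; apply: continuous_measurable_fun.
exact: sqrt_continuous.
Qed.

Lemma measurable_fun_inv_ge0 D f : measurable_fun D f -> (forall y, 0 <= f y) ->
  measurable_fun D (fun y => (f y)^-1).
Proof.
move=> mf f0; under eq_fun do rewrite -powR_inv1//.
exact: (measurableT_comp (measurable_powR (-1))).
Qed.

End measurable_real.

Section fubini_tuple.
Variable R : realType.
Local Notation T m := (m.-tuple (measurableTypeR R)).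

(** The same measure, unbundled so that its sigma-finiteness can be declared. *)
Definition tuple_vol (m : nat) : set (T m) -> \bar R := lebesgue_tuple R m.
HB.instance Definition _ m := Measure.on (tuple_vol (m:=m)).

(** Exhaustion by the cubes [-k, k]^m. *)
Lemma tuple_vol_sigma_finite m : sigma_finite [set: T m] (@tuple_vol m).
Proof.
exists (fun k => [set y | forall j, `[- k%:R, k%:R]%classic (tnth y j)]).
  apply/esym/seteqP; split => // y _.
  have [K hK] : exists K : nat, forall j, `|tnth y j| <= K%:R.
    exists (Num.truncn (\sum_j `|tnth y j|)).+1 => j.
    apply: (@le_trans _ _ (\sum_j `|tnth y j|)); last first.
      exact/ltW/truncnS_gt.
    by rewrite (bigD1 j)//= lerDl sumr_ge0.
  by exists K => //= j; rewrite in_itv/= -ler_norml.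
move=> k; split.
  rewrite (_ : mkset _ = \bigcap_(i in [set: 'I_m])
    ((fun y : T m => tnth y i) @^-1` `[- k%:R, k%:R]%classic)).
    apply: fin_bigcap_measurable => // i _.
    by rewrite -[X in measurable X]setTI; exact: measurable_tnth.
  by apply/seteqP; split => y /= h i; [move=> _|]; exact: h.
rewrite /tuple_vol (@lebesgue_tuple_box R m (fun=> `[- k%:R, k%:R]%classic))//.
rewrite -ge0_fin_numE; last by apply: prode_ge0 => i _; exact: measure_ge0.
apply: prode_fin_num => i _; rewrite ge0_fin_numE ?measure_ge0//.
by rewrite lebesgue_measure_itv/=; case: ifP; rewrite ?ltry// -EFinD ltry.
Qed.
HB.instance Definition _ m := @Measure_isSigmaFinite.Build _ _ _ (@tuple_vol m)
  (@tuple_vol_sigma_finite m).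

(** [lebesgue_cons] uses the product that integrates the tail last; it agrees
    with the other product on rectangles, hence everywhere by sigma-finiteness,
    and Tonelli's theorem applies. *)
Lemma integral_tuple_vol_cons m (g : T m.+1 -> \bar R) :
  measurable_fun [set: T m.+1] g -> (forall y, 0 <= g y)%E ->
  (\int[lebesgue_tuple R m.+1]_y g y =
   \int[lebesgue_tuple R m]_y \int[lebesgue_measure]_t g (tuple_cons (t, y)))%E.
Proof.
move=> mg g0.
have mc : measurable_fun [set: measurableTypeR R * T m] (@tuple_cons R m).
  exact: measurable_tuple_cons.
rewrite /= /lebesgue_cons.
rewrite (ge0_integral_pushforward mc)//=.
rewrite preimage_setT.
pose gc : measurableTypeR R * T m -> \bar R := g \o @tuple_cons R m.
have mgc : measurable_fun [set: measurableTypeR R * T m] gc by exact: measurableT_comp.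
transitivity (\int[lebesgue_measure \x
    (@tuple_vol m : {sigma_finite_measure set (T m) -> \bar R})]_z gc z)%E; last first.
  by rewrite (@fubini_tonelli2 _ _ _ _ _ _ _ gc mgc)// => z; exact: g0.
apply: eq_measure_integral => A mA _; apply/esym.
apply: product_measure_unique => // B C mB mC.
by rewrite -(@product_measure2E _ _ _ _ _ lebesgue_measure (@lebesgue_tuple R m)).
Qed.

(** Integrals of products of one-variable functions split; this brings the
    Gaussian integral over [R^m] down to dimension one. *)
Lemma integral_tuple_vol_prod m (f : 'I_m -> measurableTypeR R -> R) (c : R) :
  (forall i, measurable_fun setT (f i)) -> (forall i t, 0 <= f i t) ->
  (forall i, \int[lebesgue_measure]_t (f i t)%:E = c%:E)%E ->
  (\int[lebesgue_tuple R m]_y (\prod_(i < m) f i (tnth y i))%:E = (c ^+ m)%:E)%E.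
Proof.
elim: m f => [|m IH] f mf f0 fc.
  under eq_integral do rewrite big_ord0.
  by rewrite integral_cst//= diracT mule1.
rewrite integral_tuple_vol_cons//; last 2 first.
- apply/measurable_EFinP/measurable_prod => i _.
  by apply: measurableT_comp => //; exact: measurable_tnth.
- by move=> y; rewrite lee_fin prodr_ge0.
have inner (y : T m) : (\int[lebesgue_measure]_t
      (\prod_(i < m.+1) f i (tnth (tuple_cons (t, y)) i))%:E =
    c%:E * (\prod_(i < m) f (lift ord0 i) (tnth y i))%:E)%E.
  rewrite -(fc ord0) muleC -ge0_integralZl//=; last 3 first.
  - exact/measurable_EFinP.
  - by move=> t _; rewrite lee_fin.
  - by rewrite lee_fin prodr_ge0.
  apply: eq_integral => t _; rewrite big_ord_recl/= mulrC EFinM; congr (_%:E * _)%E.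
  by apply: eq_bigr => i _; rewrite tnthS.
under eq_integral do rewrite inner.
rewrite ge0_integralZl//=; last 3 first.
- apply/measurable_EFinP/measurable_prod => i _.
  by apply: measurableT_comp => //; exact: measurable_tnth.
- by move=> y _; rewrite lee_fin prodr_ge0.
- by rewrite -(fc ord0) integral_ge0// => t _; rewrite lee_fin.
by rewrite (IH (fun i => f (lift ord0 i)))// exprS EFinM.
Qed.
End fubini_tuple.

(** * One-dimensional integrals *)

Section half_line.
Variable R : realType.
Local Notation mu := (@lebesgue_measure R).
Local Notation half := (`]0%R, +oo[%classic : set R).

Lemma ge0_integral_half_line_scale (G : R -> R) (a : R) : 0 < a ->
  {within `[0, +oo[, continuous G} -> {in `]0, +oo[, forall t, 0 <= G t} ->
  (\int[mu]_(t in half) (G t)%:E =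
   a%:E * \int[mu]_(t in half) (G (a * t))%:E)%E.
Proof.
move=> a0 cG G0.
pose F (t : R) := a * t.
have F1 (t : R) : is_derive t 1 F a.
  by apply: is_derive_eq; rewrite /= /GRing.scale/= mulr1.
have dF : derive1 F = cst a by apply/funext => t; rewrite derive1E derive_val.
have FE : F 0 = 0 by rewrite /F mulr0.
have mG : measurable_fun half G.
  have : measurable_fun (`[0%R, +oo[%classic : set R) G.
    exact: subspace_continuous_measurable_fun.
  by apply: measurable_funS => // t /=; rewrite !in_itv/= !andbT => /ltW.
have mGa : measurable_fun half (fun t => G (a * t)).
  apply: (@measurable_comp _ _ _ _ _ _ half) => //.
  by move=> _ [t /= + <-]; rewrite !in_itv/= !andbT => t0; rewrite mulr_gt0.
rewrite integral_itv_obnd_cbnd; last exact/measurable_EFinP.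
rewrite -{1}FE increasing_ge0_integration_by_substitutiony; first last.
- by rewrite FE.
- by rewrite FE.
- exact/gt0_cvgMry.
- split; first by move=> t _; exact: ex_derive.
  apply: cvg_at_right_filter; apply: differentiable_continuous.
  by apply/derivable1_diffP; exact: ex_derive.
- by rewrite dF; exact: is_cvg_cst.
- by rewrite dF; exact: is_cvg_cst.
- by move=> t _; rewrite dF; exact: cst_continuous.
- by move=> s t _ _; rewrite /F ltr_pM2l.
rewrite dF.
rewrite -integral_itv_obnd_cbnd; last first.
  by apply/measurable_EFinP/measurable_funM.
rewrite -ge0_integralZl//.
- by apply: eq_integral => t _ /=; rewrite muleC.
- exact/measurable_EFinP.
- move=> t; rewrite /= in_itv/= andbT => t0; rewrite lee_fin G0//.
  by rewrite in_itv/= andbT mulr_gt0.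
- by rewrite lee_fin ltW.
Qed.

Lemma integral_half_gauss (t : R) : 0 < t ->
  (\int[mu]_(s in half) (expR (- (t * s ^+ 2)))%:E =
   (Num.sqrt pi / 2 / Num.sqrt t)%:E)%E.
Proof.
move=> t0.
have st0 : 0 < Num.sqrt t by rewrite sqrtr_gt0.
have H : (Num.sqrt pi / 2)%:E = ((Num.sqrt t)%:E *
    \int[mu]_(s in half) (gauss_fun (Num.sqrt t * s))%:E)%E.
  rewrite -integral0y_gauss -ge0_integral_half_line_scale//.
  - rewrite integral_itv_obnd_cbnd//.
    by apply/measurable_EFinP/measurable_funTS; exact: measurable_gauss_fun.
  - exact/continuous_subspaceT/continuous_gauss_fun.
  - by move=> s _; exact: gauss_fun_ge0.
rewrite (_ : (_ / _)%:E = (Num.sqrt t)^-1%:E * (Num.sqrt pi / 2)%:E)%E; last first.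
  by rewrite -EFinM mulrC.
rewrite H muleA -EFinM mulVf ?gt_eqF// mul1e.
by apply: eq_integral => s _; rewrite /gauss_fun exprMn sqr_sqrtr ?ltW.
Qed.

Lemma integral_gauss_scaled (t c : R) : 0 < t ->
  (\int[mu]_s (expR (- (t * (s - c) ^+ 2)))%:E =
   (Num.sqrt pi / Num.sqrt t)%:E)%E.
Proof.
move=> t0.
have s0 : (Num.sqrt (t *+ 2))^-1 != 0 :> R.
  by rewrite invr_neq0// sqrtr_eq0 -ltNge pmulrn_lgt0.
have := integral_normal_pdf c (Num.sqrt (t *+ 2))^-1.
under eq_integral do rewrite normal_pdfE// EFinM.
rewrite ge0_integralZl//=; last 3 first.
- by apply/measurable_EFinP; exact: measurable_normal_fun.
- by move=> y _; rewrite lee_fin normal_fun_ge0.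
- by rewrite lee_fin normal_peak_ge0.
have p0 := normal_peak_gt0 s0.
move=> /(congr1 (fun z => (normal_peak (Num.sqrt (t *+ 2))^-1)^-1%:E * z)%E).
rewrite muleA -EFinM mulVf ?gt_eqF// mul1e mule1.
have sE : (Num.sqrt (t *+ 2))^-1 ^+ 2 = (t *+ 2)^-1.
  by rewrite exprVn sqr_sqrtr// pmulrn_lge0// ltW.
rewrite /normal_peak sE invrK => H.
transitivity (\int[mu]_s (normal_fun c (Num.sqrt (t *+ 2))^-1 s)%:E)%E.
  apply: eq_integral => y _; rewrite /normal_fun sE; congr (expR _)%:E.
  by field; rewrite gt_eqF.
rewrite H; congr EFin; rewrite -sqrtrV ?ltW// -sqrtrM ?pi_ge0//; congr Num.sqrt.
by field; rewrite gt_eqF.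
Qed.

Lemma integral_half_oneDsqr (x : R) : 0 < x ->
  (\int[mu]_(s in half) (s ^+ 2 + x ^+ 2)^-1%:E = (pi / 2 / x)%:E)%E.
Proof.
move=> x0.
have co : continuous (fun s : R => (oneDsqr s)^-1) by exact: continuous_oneDsqrV.
have mo : measurable_fun setT (fun s : R => (oneDsqr s)^-1).
  exact: continuous_measurable_fun.
have H : (pi / 2)%:E = (x^-1%:E *
    \int[mu]_(s in half) (oneDsqr (x^-1 * s))^-1%:E)%E.
  rewrite -integral0y_oneDsqr.
  rewrite -(@ge0_integral_half_line_scale (fun s => (oneDsqr s)^-1)) ?invr_gt0//.
  - rewrite integral_itv_obnd_cbnd//; exact/measurable_EFinP/measurable_funTS.
  - exact/continuous_subspaceT.
rewrite EFinM H muleC muleA -EFinM -ge0_integralZl//.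
- apply: eq_integral => s _; rewrite -EFinM /oneDsqr /=; congr EFin; field.
  by rewrite !gt_eqF// ltr_wpDr ?sqr_ge0// exprn_gt0.
- apply/measurable_EFinP; apply: measurable_funTS => /=.
  by apply: (measurableT_comp mo) => //; exact: mulrl_measurable.
- by rewrite lee_fin divr_ge0 ?invr_ge0 ?ltW.
Qed.

Lemma integral_half_exp (a : R) : 0 < a ->
  (\int[mu]_(t in half) (expR (- (a * t)))%:E = a^-1%:E)%E.
Proof.
move=> a0.
have me : measurable_fun setT (fun t => expR (- (a * t))).
  by do 2 apply: measurableT_comp => //; exact: mulrl_measurable.
have := integral_exponential_pdf a0.
rewrite /exponential_pdf.
rewrite (_ : (fun t : R => _) = (EFin \o (fun t => a * expR (- a * t))) \_ `[0, +oo[).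
  rewrite -integral_mkcond -integral_itv_obnd_cbnd; last first.
    apply/measurable_EFinP/measurable_funTS/measurable_funM => //.
    by under eq_fun do rewrite mulNr.
  under eq_integral do rewrite /= EFinM.
  rewrite ge0_integralZl//; last by rewrite lee_fin ltW.
  under eq_integral do rewrite mulNr.
  move=> /(congr1 (fun z => a^-1%:E * z)%E).
  by rewrite muleA -EFinM mulVf ?gt_eqF// mul1e mule1.
  apply/measurable_EFinP; apply: measurable_funTS => /=.
  by under eq_fun do rewrite mulNr.
by apply/funext => t; rewrite /= !patchE; case: ifP.
Qed.
End half_line.

(** * Inverse powers as mixtures of exponentials *)

Section normalization.
Variable R : realType.
Local Notation mu := (@lebesgue_measure R).
Local Notation half := (`]0%R, +oo[%classic : set R).
Local Notation T m := (m.-tuple (measurableTypeR R)).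

(** Extension by zero reduces this to Tonelli's theorem on the whole line. *)
Lemma fubini_tonelli_half_line d (Y : measurableType d)
    (nu : {sigma_finite_measure set Y -> \bar R}) (g : Y * R -> R) :
  measurable_fun ([set: Y] `*` half) g -> (forall z, half z.2 -> 0 <= g z) ->
  (\int[nu]_y \int[mu]_(t in half) (g (y, t))%:E =
   \int[mu]_(t in half) \int[nu]_y (g (y, t))%:E)%E.
Proof.
move=> mg g0.
have mh : measurable ([set: Y] `*` half) by exact: measurableX.
pose G := (EFin \o g) \_ ([set: Y] `*` half).
have mG : measurable_fun setT G.
  by apply/(measurable_restrictT _ mh); exact/measurable_EFinP.
have G0 z : (0 <= G z)%E.
  by rewrite /G patchE; case: ifPn => //; rewrite inE => -[_ /g0]; rewrite lee_fin.
have GE y t : G (y, t) = ((fun t => (g (y, t))%:E) \_ half) t.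
  rewrite /G !patchE; congr (if _ then _ else _).
  by apply/idP/idP; rewrite !inE//= => -[].
transitivity (\int[nu]_y \int[mu]_t G (y, t))%E.
  by apply: eq_integral => y _; rewrite integral_mkcond; apply: eq_integral => t _.
rewrite (@fubini_tonelli _ _ _ _ _ nu mu G mG G0) [RHS]integral_mkcond.
apply: eq_integral => t _; under eq_integral do rewrite GE.
rewrite patchE; case: ifPn => [|] th.
  by apply: eq_integral => y _; rewrite patchE th.
by rewrite integral0_eq// => y _; rewrite patchE (negbTE th).
Qed.

Lemma measurable_half_gamma2 (x : R) : measurable_fun setT
  (fun t : R => (Num.sqrt t)^-1 * expR (- (t * x ^+ 2))).
Proof.
apply: measurable_funM.
  apply: measurable_fun_inv_ge0 => [|t]; last exact: sqrtr_ge0.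
  exact: measurable_fun_sqrt.
apply: measurableT_comp => //; apply: measurableT_comp => //.
exact: mulrr_measurable.
Qed.

(** Up to scaling this is Gamma(1/2).  Once [1 / sqrt t] is written as a Gaussian
    integral over [s], exchanging the integrals leaves that of
    [1 / (s^2 + x^2)], an arctangent. *)
Lemma integral_half_gamma2 (x : R) : 0 < x ->
  (\int[mu]_(t in half) ((Num.sqrt t)^-1 * expR (- (t * x ^+ 2)))%:E =
   (Num.sqrt pi / x)%:E)%E.
Proof.
move=> x0.
pose c : R := Num.sqrt pi / 2.
have c0 : 0 < c by rewrite divr_gt0// sqrtr_gt0 pi_gt0.
have cVc : c^-1 * c = 1 by rewrite mulVf// gt_eqF.
have q0 (s : R) : 0 < s ^+ 2 + x ^+ 2.
  by rewrite ltr_wpDl ?sqr_ge0// exprn_gt0.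
have mg : measurable_fun setT (fun z : R * R => expR (- (z.2 * (z.1 ^+ 2 + x ^+ 2)))).
  do 2 apply: measurableT_comp => //; apply: measurable_funM => //.
  by apply: measurable_funD => //; exact: measurable_funX.
have measurable_gs (t : R) : measurable_fun half (fun s => (expR (- (t * s ^+ 2)))%:E).
  apply/measurable_EFinP; apply: measurable_funTS.
  do 2 apply: measurableT_comp => //; apply: measurable_funM => //.
have half_fubini : (\int[mu]_(s in half) \int[mu]_(t in half)
    (expR (- (t * (s ^+ 2 + x ^+ 2))))%:E =
  \int[mu]_(t in half) \int[mu]_(s in half)
    (expR (- (t * (s ^+ 2 + x ^+ 2))))%:E)%E.
  rewrite integral_mkcond/=.
  transitivity (\int[mu]_s (\int[mu]_(t in half) (\1_half s *
     expR (- (t * (s ^+ 2 + x ^+ 2))))%:E))%E.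
    apply: eq_integral => s _; rewrite patchE indicE; case: ifPn => _.
      by apply: eq_integral => t _; rewrite mul1r.
    by rewrite integral0_eq// => t _; rewrite mul0r.
  rewrite (@fubini_tonelli_half_line _ _ mu (fun z => \1_half z.1 *
     expR (- (z.2 * (z.1 ^+ 2 + x ^+ 2)))))/=; last 2 first.
  - apply: measurable_funTS; apply: measurable_funM => //.
    by apply: measurableT_comp => //; exact: measurable_indic.
  - by move=> z _; rewrite mulr_ge0 ?expR_ge0.
  apply: eq_integral => t _; rewrite [RHS]integral_mkcond; apply: eq_integral => s _.
  by rewrite patchE indicE; case: ifPn => _; rewrite ?mul1r ?mul0r.
transitivity (c^-1%:E * \int[mu]_(t in half) \int[mu]_(s in half)
    (expR (- (t * (s ^+ 2 + x ^+ 2))))%:E)%E.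
  transitivity (c^-1%:E * \int[mu]_(t in half)
      (c * ((Num.sqrt t)^-1 * expR (- (t * x ^+ 2))))%:E)%E; last first.
    congr (_ * _)%E; apply: eq_integral => t; rewrite inE/= in_itv/= andbT => t0.
    under eq_integral do rewrite mulrDr opprD expRD EFinM.
    rewrite ge0_integralZr.
    - rewrite (integral_half_gauss t0).
      by rewrite -EFinM mulrA.
    - by [].
    - exact: measurable_gs.
    - by move=> s _; rewrite lee_fin expR_ge0.
    - by rewrite lee_fin expR_ge0.
  under [X in (_ = _ * X)%E]eq_integral do rewrite EFinM.
  rewrite ge0_integralZl.
  - by rewrite muleA -EFinM cVc mul1e.
  - by [].
  - apply/measurable_EFinP; apply: measurable_funTS; exact: measurable_half_gamma2.
  - by move=> t _; rewrite lee_fin mulr_ge0 ?expR_ge0// invr_ge0 sqrtr_ge0.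
  - by rewrite lee_fin ltW.
rewrite -half_fubini.
transitivity (c^-1%:E * (pi / 2 / x)%:E)%E.
  congr (_ * _)%E; rewrite -(integral_half_oneDsqr x0); apply: eq_integral => s _.
  under eq_integral => t _ do rewrite (mulrC t).
  exact: integral_half_exp (q0 s).
rewrite -EFinM /c.
have : Num.sqrt (@pi R) ^+ 2 = @pi R.
  by apply: sqr_sqrtr; exact: pi_ge0.
have : 0 < Num.sqrt (@pi R) by rewrite sqrtr_gt0 pi_gt0.
move: (Num.sqrt (@pi R)) => w w0 <-; congr EFin.
by field; rewrite !gt_eqF.
Qed.

(** Up to the factor Gamma(s), [q^(-s)] is a mixture of the exponentials
    [exp (- t q)]. *)
Lemma gamma_scale (s q : R) : 1 < s -> 0 < q ->
  (\int[mu]_(t in half) (t `^ (s - 1) * expR (- (t * q)))%:E =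
   (q `^ (- s))%:E * \int[mu]_(t in half) (t `^ (s - 1) * expR (- t))%:E)%E.
Proof.
move=> s1 q0.
have measurable_gammaq : measurable_fun setT
    (fun t : R => (q * t) `^ (s - 1) * expR (- (q * t))).
  apply: measurable_funM.
    apply: (measurableT_comp (measurable_powR _)).
    exact: mulrl_measurable.
  by do 2 apply: measurableT_comp => //.
have continuous_gamma :
    {within `[0%R, +oo[, continuous (fun t : R => t `^ (s - 1) * expR (- t))}.
  apply/continuous_within_itvcyP; split.
    move=> t; rewrite in_itv/= andbT => t0.
    apply: cvgM; last first.
      by apply: continuous_comp; [exact: continuousN|exact: continuous_expR].
    have /derivable1_diffP/differentiable_continuous cp :
        derivable (fun u : R => u `^ (s - 1)) t 1.
      by apply: ex_derive; exact: is_derive1_powR.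
    exact: cp.
  rewrite powR0; last by rewrite gt_eqF// subr_gt0.
  apply: cvgM.
    by apply: powR_cvg0; rewrite subr_gt0.
  apply: cvg_at_right_filter.
  by apply: continuous_comp; [exact: continuousN|exact: continuous_expR].
rewrite (@ge0_integral_half_line_scale _ (fun t => t `^ (s - 1) * expR (- t)) _ q0);
  last 2 first.
- exact: continuous_gamma.
- by move=> t _; rewrite mulr_ge0 ?powR_ge0 ?expR_ge0.
rewrite muleA -EFinM -ge0_integralZl; last 4 first.
- by [].
- by apply/measurable_EFinP; apply: measurable_funTS; exact: measurable_gammaq.
- by move=> t _; rewrite lee_fin mulr_ge0 ?powR_ge0 ?expR_ge0.
- by rewrite lee_fin mulr_ge0 ?powR_ge0// ltW.
apply: eq_integral => t; rewrite inE/= in_itv/= andbT => t0.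
have qV : q `^ (- s) * q * q `^ (s - 1) = 1.
  rewrite -[X in _ * X * _](powRr1 (ltW q0)) -!powRD.
  - by rewrite (_ : _ + _ = 0) ?powRr0//; ring.
  - by rewrite (gt_eqF q0) implybT.
  - by rewrite (gt_eqF q0) implybT.
rewrite -EFinM powRM ?ltW// (mulrC q t); congr EFin.
by rewrite !mulrA qV mul1r.
Qed.
End normalization.

(** * The mass of the Poisson kernel *)

Section poisson_mass.
Variables (R : realType) (m : nat).
Local Notation mu := (@lebesgue_measure R).
Local Notation half := (`]0%R, +oo[%classic : set R).
Local Notation Y := (m.-tuple (measurableTypeR R)).
Implicit Types (x : 'rV[R]_m.+1) (y : Y).

(** [|y - x|^2], with the normal part split off: what is left is a sum over
    the entries of the tuple, so that [exp (- t sqdist)] is a product of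
    one-variable functions. *)
Definition sqdist x y : R :=
  x 0 ord_max ^+ 2 + \sum_(i < m) (tnth y i - x 0 (lift ord_max i)) ^+ 2.

Definition sqnorm x : R := \sum_i x 0 i ^+ 2.

Lemma enormE x : enorm x = Num.sqrt (sqnorm x). Proof. by []. Qed.

Lemma sqdistE x y : sqdist x y = sqnorm (boundary_point y - x).
Proof.
rewrite /sqdist /sqnorm (bigD1_ord ord_max)//=; congr (_ + _).
  by rewrite !mxE unlift_none sub0r sqrrN.
by apply: eq_bigr => i _; rewrite !mxE liftK.
Qed.

Lemma enorm_boundary x y : enorm (boundary_point y - x) = Num.sqrt (sqdist x y).
Proof. by rewrite enormE sqdistE. Qed.

Lemma measurable_sqdist x : measurable_fun setT (sqdist x).
Proof.
apply: measurable_funD => //; apply: measurable_sum => i.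
apply: measurable_funX; apply: measurable_funB => //.
exact: measurable_tnth.
Qed.

Lemma sqdist_gt0 x y : half_space x -> 0 < sqdist x y.
Proof.
by move=> x0; rewrite ltr_pwDl ?exprn_gt0// sumr_ge0// => i _; rewrite sqr_ge0.
Qed.

Lemma powR_sqrtN (q : R) k : 0 < q -> q `^ (- (k%:R / 2)) = (Num.sqrt q ^+ k)^-1.
Proof.
move=> q0; rewrite powRN mulrC powRrM powR12_sqrt ?ltW// powR_mulrn//.
Qed.

Lemma integral_boundary_gauss x (t : R) : 0 < t ->
  (\int[lebesgue_tuple R m]_y (expR (- (t * sqdist x y)))%:E =
   (expR (- (t * x 0 ord_max ^+ 2)) * (Num.sqrt pi / Num.sqrt t) ^+ m)%:E)%E.
Proof.
move=> t0.
pose f (i : 'I_m) (s : measurableTypeR R) : R :=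
  expR (- (t * (s - x 0 (lift ord_max i)) ^+ 2)).
have mf i : measurable_fun setT (f i).
  do 2 apply: measurableT_comp => //; apply: measurable_funM => //.
  by apply: measurable_funX; exact: measurable_funB.
have f0 i s : 0 <= f i s by exact: expR_ge0.
have fc i : (\int[mu]_s (f i s)%:E = (Num.sqrt pi / Num.sqrt t)%:E)%E.
  exact: integral_gauss_scaled.
rewrite EFinM -(integral_tuple_vol_prod mf f0 fc) -ge0_integralZl; last 4 first.
- by [].
- apply/measurable_EFinP; apply: measurable_prod => i _.
  by apply: measurableT_comp => //; exact: measurable_tnth.
- by move=> y _; rewrite lee_fin prodr_ge0.
- by rewrite lee_fin expR_ge0.
apply: eq_integral => y _; rewrite -EFinM; congr EFin.
rewrite /sqdist mulrDr opprD expRD; congr (_ * _).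
by rewrite mulr_sumr -sumrN expR_sum.
Qed.

(** Insert the mixture of [gamma_scale] for [|y - x|^(-n)] and integrate over
    [y] first.  The powers of [t] then combine to [1 / sqrt t] in every
    dimension, which is the integrand of [integral_half_gamma2]. *)
Lemma poisson_mass_gamma x : (1 < m)%N -> half_space x ->
  (\int[lebesgue_tuple R m]_y (Num.sqrt (sqdist x y) ^+ m.+1)^-1%:E *
   \int[mu]_(t in half) (t `^ (m.+1%:R / 2 - 1) * expR (- t))%:E =
   (Num.sqrt pi ^+ m.+1 / x 0 ord_max)%:E)%E.
Proof.
move=> m1 x0; set s : R := m.+1%:R / 2.
have s1 : 1 < s by rewrite /s ltr_pdivlMr// mul1r ltr_nat.
have mq : measurable_fun setT (fun y => (Num.sqrt (sqdist x y) ^+ m.+1)^-1).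
  apply: measurable_fun_inv_ge0 => [|y]; last by rewrite exprn_ge0.
  apply: measurable_funX; apply: measurable_fun_sqrt; exact: measurable_sqdist.
rewrite -ge0_integralZr; last 4 first.
- by [].
- exact/measurable_EFinP.
- by move=> y _; rewrite lee_fin invr_ge0 exprn_ge0.
- by rewrite integral_ge0// => t _; rewrite lee_fin mulr_ge0 ?powR_ge0 ?expR_ge0.
transitivity (\int[lebesgue_tuple R m]_y \int[mu]_(t in half)
    (t `^ (s - 1) * expR (- (t * sqdist x y)))%:E)%E.
  apply: eq_integral => y _; rewrite (gamma_scale s1 (sqdist_gt0 y x0)).
  by rewrite powR_sqrtN// sqdist_gt0.
rewrite (@fubini_tonelli_half_line R _ _ (@tuple_vol R m)
  (fun z => z.2 `^ (s - 1) * expR (- (z.2 * sqdist x z.1)))); last 2 first.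
- apply: measurable_funTS; apply: measurable_funM.
    exact: (measurableT_comp (measurable_powR _)).
  do 2 apply: measurableT_comp => //; apply: measurable_funM => //.
  by apply: measurableT_comp => //; exact: measurable_sqdist.
- by move=> z _; rewrite mulr_ge0 ?powR_ge0 ?expR_ge0.
rewrite exprS mulrAC mulrC EFinM -(integral_half_gamma2 x0) -ge0_integralZl; last 4 first.
- by [].
- apply/measurable_EFinP; apply: measurable_funTS; exact: measurable_half_gamma2.
- by move=> t _; rewrite lee_fin mulr_ge0 ?expR_ge0// invr_ge0 sqrtr_ge0.
- by rewrite lee_fin exprn_ge0.
apply: eq_integral => t; rewrite inE/= in_itv/= andbT => t0.
under eq_integral do rewrite EFinM.
rewrite ge0_integralZl; last 4 first.
- by [].
- apply/measurable_EFinP.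
  do 2 apply: measurableT_comp => //; apply: measurable_funM => //.
  exact: measurable_sqdist.
- by move=> y _; rewrite lee_fin expR_ge0.
- by rewrite lee_fin powR_ge0.
rewrite (integral_boundary_gauss x t0) -!EFinM; congr EFin.
have st0 : 0 < Num.sqrt t by rewrite sqrtr_gt0.
have -> : t `^ (s - 1) = Num.sqrt t ^+ m / Num.sqrt t.
  rewrite powRB; last by rewrite (gt_eqF t0) implybT.
  rewrite powRr1 ?ltW//.
  rewrite -[s]opprK powRN powR_sqrtN// invrK -{2}(sqr_sqrtr (ltW t0)) exprS.
  by field; rewrite gt_eqF.
move: st0 (expR _) => st0 E.
rewrite expr_div_n.
by field; rewrite expf_neq0 gt_eqF.
Qed.

(** Applied to [poisson_mass_gamma], this yields at once that the Gamma
    integral and the mass of the Poisson kernel are finite and nonzero. *)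
Lemma mule_eq_fin_gt0 (I G : \bar R) (r : R) : (0 <= I)%E -> (0 <= G)%E -> 0 < r ->
  (I * G = r%:E)%E -> exists i g : R, [/\ I = i%:E, G = g%:E, 0 < g & i * g = r].
Proof.
case: I G => [i| |] [g| |] //=; rewrite ?lee_fin => i0 g0 r0.
- move=> [igr]; exists i, g; split => //.
  by rewrite lt_neqAle g0 andbT; apply: contraTneq r0 => g0'; rewrite -igr -g0' mulr0 ltxx.
- move: i0; rewrite le_eqVlt => /predU1P[<-|i0].
    by rewrite mul0e => -[r0']; rewrite -r0' ltxx in r0.
  by rewrite mulry gtr0_sg// mul1e.
- move: g0; rewrite le_eqVlt => /predU1P[<-|g0].
    by rewrite mule0 => -[r0']; rewrite -r0' ltxx in r0.
  by rewrite mulyr gtr0_sg// mul1e.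
Qed.

Definition poisson_kernel x y : R :=
  2 / sphere_area R m.+1 * (x 0 ord_max / Num.sqrt (sqdist x y) ^+ m.+1).

Lemma Gamma_half : (1 < m)%N -> 0 < Gamma (m.+1%:R / 2 : R) /\
  forall x, half_space x ->
  (\int[lebesgue_tuple R m]_y (Num.sqrt (sqdist x y) ^+ m.+1)^-1%:E =
   (Num.sqrt pi ^+ m.+1 / x 0 ord_max / Gamma (m.+1%:R / 2))%:E)%E.
Proof.
move=> m1.
suff H x : half_space x -> 0 < Gamma (m.+1%:R / 2 : R) /\
  (\int[lebesgue_tuple R m]_y (Num.sqrt (sqdist x y) ^+ m.+1)^-1%:E =
   (Num.sqrt pi ^+ m.+1 / x 0 ord_max / Gamma (m.+1%:R / 2))%:E)%E.
  split; last by move=> x /H[].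
  have /H[]// : half_space (const_mx 1 : 'rV[R]_m.+1) by rewrite /half_space/= mxE.
move=> x0; have := poisson_mass_gamma m1 x0.
case/mule_eq_fin_gt0.
- by rewrite integral_ge0// => y _; rewrite lee_fin invr_ge0 exprn_ge0.
- by rewrite integral_ge0// => t _; rewrite lee_fin mulr_ge0 ?powR_ge0 ?expR_ge0.
- by rewrite divr_gt0// exprn_gt0// sqrtr_gt0 pi_gt0.
move=> i [g [-> gE g0 igr]].
have -> : Gamma (m.+1%:R / 2 : R) = g by rewrite /Gamma /Rintegral gE.
by split=> //; rewrite -igr mulfK// gt_eqF.
Qed.

Lemma sphere_area_gt0 : (1 < m)%N -> 0 < sphere_area R m.+1.
Proof.
move=> /Gamma_half[g0 _]; rewrite divr_gt0// mulr_gt0//.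
by rewrite powR_gt0// pi_gt0.
Qed.

Lemma poisson_kernel_gt0 x y : (1 < m)%N -> half_space x -> 0 < poisson_kernel x y.
Proof.
move=> m1 x0; rewrite mulr_gt0// divr_gt0// ?sphere_area_gt0//.
by rewrite exprn_gt0// sqrtr_gt0 sqdist_gt0.
Qed.

Lemma measurable_sqrt_sqdistX x k :
  measurable_fun setT (fun y => (Num.sqrt (sqdist x y) ^+ k)^-1).
Proof.
apply: measurable_fun_inv_ge0 => [|y]; last by rewrite exprn_ge0.
by apply: measurable_funX; apply: measurable_fun_sqrt; exact: measurable_sqdist.
Qed.

Lemma measurable_poisson_kernel x : measurable_fun setT (poisson_kernel x).
Proof.
apply: measurable_funM => //; apply: measurable_funM => //.
exact: measurable_sqrt_sqdistX.
Qed.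

Lemma poisson_kernel_mass x : (1 < m)%N -> half_space x ->
  (\int[lebesgue_tuple R m]_y (poisson_kernel x y)%:E = 1)%E.
Proof.
move=> m1 x0; have [g0 /(_ _ x0) H] := Gamma_half m1.
under eq_integral do rewrite /poisson_kernel mulrA EFinM.
rewrite ge0_integralZl; last 4 first.
- by [].
- by apply/measurable_EFinP; exact: measurable_sqrt_sqdistX.
- by move=> y _; rewrite lee_fin invr_ge0 exprn_ge0.
- apply: ltW; rewrite lte_fin mulr_gt0// divr_gt0//; exact: sphere_area_gt0.
rewrite H -EFinM; congr EFin.
have -> : sphere_area R m.+1 = 2 * Num.sqrt pi ^+ m.+1 / Gamma (m.+1%:R / 2).
  rewrite /sphere_area -[X in _ = _ * X / _]invrK -powR_sqrtN ?pi_gt0//.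
  by rewrite powRN invrK.
have p0 : 0 < Num.sqrt (@pi R) by rewrite sqrtr_gt0 pi_gt0.
move: (Gamma _) (Num.sqrt _) g0 p0 => g p g0 p0.
have xn0 : 0 < x 0 ord_max by [].
by field; rewrite expf_neq0 ?gt_eqF.
Qed.

Lemma poissonE f x : poisson f x =
  2 / sphere_area R m.+1 *
  \int[lebesgue_tuple R m]_y (x 0 ord_max / Num.sqrt (sqdist x y) ^+ m.+1 * f y).
Proof.
rewrite /poisson; congr (_ * _); apply: eq_Rintegral => y _.
by rewrite enorm_boundary.
Qed.

End poisson_mass.

(** * Differentiation under the integral sign *)

Section kernel_derivative.
Context (R : realType).

Lemma is_derive_kernel (a b q p r : R) (k : nat) (h : R) :
  let D t := q - 2 * p * t + r * t ^+ 2 in 0 < D h ->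
  is_derive h 1 (fun t => (a + b * t) / Num.sqrt (D t) ^+ k)
    (b / Num.sqrt (D h) ^+ k +
     k%:R * (a + b * h) * (p - r * h) / Num.sqrt (D h) ^+ k.+2).
Proof.
move=> D Dh.
have s0 : 0 < Num.sqrt (D h) by rewrite sqrtr_gt0.
have dD : is_derive h 1 D (- 2 * p + 2 * r * h).
  apply: is_derive_eq; rewrite /GRing.scale/=; ring.
have dS : is_derive h 1 (fun t => Num.sqrt (D t)) ((r * h - p) / Num.sqrt (D h)).
  have dsq := is_derive1_sqrt Dh.
  apply: (is_derive_eq (is_derive1_comp dsq dD)).
  by rewrite /GRing.scale/=; field; rewrite gt_eqF.
have dX : is_derive h 1 (fun t => Num.sqrt (D t) ^+ k)
    (k%:R * (r * h - p) * Num.sqrt (D h) ^+ k / Num.sqrt (D h) ^+ 2).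
  case: k => [|k].
    by rewrite !mul0r; exact: is_derive_cst.
  have := @is_deriveX _ _ (fun t => Num.sqrt (D t)) k.+1 h 1 _ dS.
  rewrite exprfctE => H; apply: (is_derive_eq H).
  by rewrite /GRing.scale/= exprS -mulr_natl; field; rewrite gt_eqF.
have dN : is_derive h 1 (fun t : R => a + b * t) b.
  by apply: is_derive_eq; rewrite /GRing.scale/=; ring.
have S0 : Num.sqrt (D h) ^+ k != 0 by rewrite expf_neq0// gt_eqF.
have dV := @is_deriveV R (fun t => Num.sqrt (D t) ^+ k) h _ 1 S0 dX.
apply: (is_derive_eq (is_deriveM dN dV)).
rewrite /GRing.scale/= !exprS; field.
by rewrite S0 gt_eqF.
Qed.
End kernel_derivative.

Section kernel_integral_derivative.
Context d (Y : measurableType d) (R : realType) (mu : {measure set Y -> \bar R}).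
Variables (a q p f : Y -> R) (b r A c delta : R) (n j : nat).
Let D y h := q y - 2 * p y * h + r * h ^+ 2.
Let K h y := (a y + b * h) / Num.sqrt (D y h) ^+ (n + j) * f y.
Let K' y := (b / Num.sqrt (q y) ^+ (n + j) +
  (n + j)%:R * a y * p y / Num.sqrt (q y) ^+ (n + j).+2) * f y.

Hypotheses (ma : measurable_fun setT a) (mq : measurable_fun setT q)
  (mp : measurable_fun setT p) (mf : measurable_fun setT f).
Hypotheses (c0 : 0 < c) (delta0 : 0 < delta).
Hypothesis A0 : 0 <= A.
Hypothesis q0 : forall y, 0 < q y.
Hypothesis D_ge : forall y (h : R), `|h| < delta -> c <= Num.sqrt (D y h).
Hypothesis q_le : forall y (h : R), `|h| < delta -> Num.sqrt (q y) <= 2 * Num.sqrt (D y h).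
Hypothesis p_le : forall y (h : R), `|p y - r * h| <= Num.sqrt (D y h).
Hypothesis a_le : forall y (h : R), `|h| < delta ->
  `|a y + b * h| <= A * Num.sqrt (D y h) ^+ j.
Hypothesis intf : mu.-integrable setT
  (EFin \o (fun y => `|f y| / Num.sqrt (q y) ^+ n)).

Let S0 y (h : R) : `|h| < delta -> 0 < Num.sqrt (D y h).
Proof. by move=> /(D_ge y); exact: lt_le_trans. Qed.

Let q_leX y (h : R) : `|h| < delta ->
  (Num.sqrt (D y h) ^+ n)^-1 <= 2 ^+ n / Num.sqrt (q y) ^+ n.
Proof.
move=> hd; have s0 := S0 y hd.
have sq0 : 0 < Num.sqrt (q y) by rewrite sqrtr_gt0.
rewrite ler_pdivlMr ?exprn_gt0// mulrC ler_pdivrMr ?exprn_gt0// -exprMn.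
by rewrite lerXn2r ?nnegrE ?sqrtr_ge0 ?mulr_ge0// q_le.
Qed.

Let K_le (h : R) y : `|h| < delta ->
  `|K h y| <= A * 2 ^+ n * (`|f y| / Num.sqrt (q y) ^+ n).
Proof.
move=> hd; have s0 := S0 y hd.
rewrite /K !normrM normfV (ger0_norm (exprn_ge0 _ (ltW s0))).
apply: (@le_trans _ _ (A * (Num.sqrt (D y h) ^+ n)^-1 * `|f y|)).
  apply: ler_wpM2r => //; rewrite ler_pdivrMr ?exprn_gt0// exprD mulrA mulfVK.
    exact: a_le.
  by rewrite expf_neq0 ?gt_eqF.
rewrite -mulrA -[leRHS]mulrA ler_wpM2l//.
rewrite mulrCA mulrC ler_wpM2l//.
exact: q_leX.
Qed.

Let C0 : 0 <= `|b| / c ^+ j + (n + j)%:R * A / c.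
Proof. by rewrite addr_ge0 ?divr_ge0 ?mulr_ge0 ?exprn_ge0 ?(ltW c0). Qed.

Let K'_le (h : R) y : `|h| < delta ->
  `|(b / Num.sqrt (D y h) ^+ (n + j) + (n + j)%:R * (a y + b * h) * (p y - r * h) /
     Num.sqrt (D y h) ^+ (n + j).+2) * f y| <=
  (`|b| / c ^+ j + (n + j)%:R * A / c) * 2 ^+ n * (`|f y| / Num.sqrt (q y) ^+ n).
Proof.
move=> hd; have s0 := S0 y hd.
rewrite normrM.
set s := Num.sqrt (D y h) in s0 *.
apply: (@le_trans _ _ ((`|b| / c ^+ j + (n + j)%:R * A / c) * (s ^+ n)^-1 * `|f y|)).
  apply: ler_wpM2r => //; rewrite mulrDl; apply: le_trans (ler_normD _ _) _.
  apply: lerD.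
    rewrite normrM normfV (ger0_norm (exprn_ge0 _ (ltW s0))) -mulrA.
    rewrite ler_wpM2l// exprD invfM mulrC ler_wpM2r ?invr_ge0 ?(exprn_ge0 _ (ltW s0))//.
    rewrite lef_pV2 ?posrE ?exprn_gt0//.
    by apply: lerXn2r; rewrite ?nnegrE ?(ltW c0) ?(ltW s0)// D_ge.
  rewrite !normrM normfV (ger0_norm (exprn_ge0 _ (ltW s0))) ger0_norm//.
  apply: (@le_trans _ _ ((n + j)%:R * (A * s ^+ j) * s / s ^+ (n + j).+2)).
    rewrite ler_wpM2r ?invr_ge0 ?(exprn_ge0 _ (ltW s0))//.
    by rewrite ler_pM ?mulr_ge0// ?ler_wpM2l ?a_le.
  rewrite (_ : _ / _ = (n + j)%:R * A * s^-1 / s ^+ n); last first.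
    by rewrite !exprS exprD; field; rewrite !expf_neq0 ?gt_eqF.
  rewrite ler_wpM2r ?invr_ge0 ?(exprn_ge0 _ (ltW s0))// ler_wpM2l ?mulr_ge0//.
  by rewrite lef_pV2 ?posrE// D_ge.
move: C0; set C1 := (`|b| / c ^+ j + _) => C10.
rewrite -mulrA -[leRHS]mulrA ler_wpM2l//.
rewrite mulrCA mulrC ler_wpM2l//; exact: q_leX.
Qed.

Let measurable_K h : measurable_fun setT (K h).
Proof.
apply: measurable_funM => //; apply: measurable_funM; first exact: measurable_funD.
apply: measurable_fun_inv_ge0 => [|y]; last by rewrite exprn_ge0.
apply: measurable_funX; apply: measurable_fun_sqrt.
apply: measurable_funD => //; apply: measurable_funB => //.
by apply: measurable_funM => //; exact: measurable_funM.
Qed.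

Let measurable_K' : measurable_fun setT K'.
Proof.
have mV k : measurable_fun setT (fun y => (Num.sqrt (q y) ^+ k)^-1).
  apply: measurable_fun_inv_ge0 => [|y]; last by rewrite exprn_ge0.
  by apply: measurable_funX; exact: measurable_fun_sqrt.
apply: measurable_funM => //; apply: measurable_funD; first exact: measurable_funM.
apply: measurable_funM => //; apply: measurable_funM => //.
exact: measurable_funM.
Qed.

Let integrable_dominated (g : Y -> R) (C : R) : measurable_fun setT g ->
  (forall y, `|g y| <= C * (`|f y| / Num.sqrt (q y) ^+ n)) ->
  mu.-integrable setT (EFin \o g).
Proof.
move=> mg gle; apply: (@le_integrable _ _ _ _ _ _ _
  (EFin \o (fun y => C * (`|f y| / Num.sqrt (q y) ^+ n)))) => //.
- exact/measurable_EFinP.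
- by move=> y _ /=; rewrite lee_fin (le_trans (gle y))// ler_norm.
exact: (integrableZl _ C intf).
Qed.

Let D0 y : D y 0 = q y.
Proof. by rewrite /D expr0n/= !mulr0 subr0 addr0. Qed.

(** For [|h| < delta] the integrand and its derivative in [h] are bounded by a
    multiple of [|f| / sqrt q ^ n]: the numerator makes up for [j] of the
    [n + j] powers, and [sqrt D] is comparable to [sqrt q].  Here [D] is the
    squared distance from a moving point to [y], and the affine numerator
    covers both the Poisson kernel and its tangential derivatives. *)
Lemma is_derive_integral_kernel :
  is_derive (0 : R) 1 (fun h => \int[mu]_y K h y) (\int[mu]_y K' y) /\
  mu.-integrable setT (EFin \o K').
Proof.
have itv0 (h : R) : `]- delta, delta[%classic h -> `|h| < delta.
  by rewrite /= in_itv/= ltr_norml.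
have d0 : `|0 : R| < delta by rewrite normr0.
have dK (h : R) y : `|h| < delta -> is_derive h 1 (K ^~ y)
  ((b / Num.sqrt (D y h) ^+ (n + j) + (n + j)%:R * (a y + b * h) * (p y - r * h) /
     Num.sqrt (D y h) ^+ (n + j).+2) * f y).
  move=> hd; have Dh : 0 < D y h by have := S0 y hd; rewrite sqrtr_gt0.
  have dk := @is_derive_kernel R (a y) b (q y) (p y) r (n + j) h Dh.
  apply: (is_derive_eq (is_deriveM dk (is_derive_cst (f y) h 1))).
  by rewrite /GRing.scale/= mulr0 add0r mulrC.
pose C := (`|b| / c ^+ j + (n + j)%:R * A / c) * 2 ^+ n.
pose G y := C * (`|f y| / Num.sqrt (q y) ^+ n).
have G0 y : 0 <= G y.
  rewrite /G /C mulr_ge0 ?divr_ge0 ?exprn_ge0//.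
  by rewrite mulr_ge0 ?exprn_ge0// C0.
have intG : mu.-integrable setT (EFin \o G).
  exact: (integrableZl _ C intf).
have I0 : `]- delta, delta[%classic (0 : R) by rewrite /= in_itv/= oppr_lt0 delta0.
have intK (h : R) : `]- delta, delta[%classic h -> mu.-integrable setT (EFin \o K h).
  by move=> /itv0 hd; apply: integrable_dominated => // y; exact: K_le.
have derK (h : R) y : `]- delta, delta[%classic h -> setT y -> derivable (K ^~ y) h 1.
  by move=> /itv0 hd _; apply: ex_derive; exact: dK.
have leK (h : R) y : `]- delta, delta[%classic h -> setT y ->
    `|partial1of2 K h y| <= G y.
  move=> /itv0 hd _; rewrite partial1of2E (@derive_val _ _ _ _ _ _ _ (dK h y hd)).
  exact: K'_le.
have K'E y : partial1of2 K 0 y = K' y.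
  rewrite partial1of2E (@derive_val _ _ _ _ _ _ _ (dK 0 y d0)) D0.
  by rewrite !mulr0 addr0 subr0.
split; last first.
  apply: (@integrable_dominated _ C) => // y.
  rewrite -K'E; exact: leK.
split; first exact: (derivable_under_integral measurableT I0 intK derK G0 intG leK).
rewrite -derive1E (differentiation_under_integral measurableT I0 intK derK G0 intG leK).
by apply: eq_Rintegral => y _; exact: K'E.
Qed.

End kernel_integral_derivative.

(** * Distances to the boundary along a line *)

Section geometry.
Variables (R : realType) (m : nat).
Local Notation Y := (m.-tuple (measurableTypeR R)).
Implicit Types (x z : 'rV[R]_m.+1) (y : Y).

Definition pairing x z y : R := \sum_i (boundary_point y - x) 0 i * z 0 i.

Lemma sqnorm_ge0 z : 0 <= sqnorm z.
Proof. by rewrite sumr_ge0// => i _; exact: sqr_ge0. Qed.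

Lemma sqnorm_line (v w : 'rV[R]_m.+1) (h : R) :
  sqnorm (v - h *: w) =
  sqnorm v - 2 * (\sum_i v 0 i * w 0 i) * h + sqnorm w * h ^+ 2.
Proof.
rewrite /sqnorm mulr_sumr !mulr_suml -sumrB -big_split/=.
by apply: eq_bigr => i _; rewrite !mxE; ring.
Qed.

Lemma cauchy_schwarz (v w : 'rV[R]_m.+1) :
  (\sum_i v 0 i * w 0 i) ^+ 2 <= sqnorm v * sqnorm w.
Proof.
set p := \sum_i _; have [r0|r0] := eqVneq (sqnorm w) 0.
  have w0 i : w 0 i = 0.
    move/eqP: r0; rewrite psumr_eq0 => [/allP/(_ i)|j _]; last exact: sqr_ge0.
    by rewrite mem_index_enum sqrf_eq0 => /(_ isT)/eqP.
  by rewrite r0 mulr0 /p big1 ?expr0n// => i _; rewrite w0 mulr0.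
have rp : 0 < sqnorm w by rewrite lt_neqAle eq_sym r0 sqnorm_ge0.
(* The point of the line through [v] in direction [w] closest to the origin. *)
have := sqnorm_ge0 (v - (p / sqnorm w) *: w).
rewrite sqnorm_line -/p => H.
have : 0 <= (sqnorm v - 2 * p * (p / sqnorm w) +
    sqnorm w * (p / sqnorm w) ^+ 2) * sqnorm w.
  by rewrite mulr_ge0// ltW.
rewrite (_ : _ * sqnorm w = sqnorm v * sqnorm w - p ^+ 2); last by field.
by rewrite subr_ge0.
Qed.

Lemma sqdist_line x z (h : R) y :
  sqdist (x + h *: z) y = sqdist x y - 2 * pairing x z y * h + sqnorm z * h ^+ 2.
Proof. by rewrite !sqdistE opprD addrA sqnorm_line. Qed.

Lemma pairing_line x z (h : R) y :
  pairing (x + h *: z) z y = pairing x z y - sqnorm z * h.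
Proof.
rewrite /pairing /sqnorm mulr_suml -sumrB; apply: eq_bigr => i _.
by rewrite !mxE; ring.
Qed.

Lemma pairing_le x z y : sqnorm z <= 1 -> `|pairing x z y| <= Num.sqrt (sqdist x y).
Proof.
move=> z1; rewrite -sqrtr_sqr; apply: ler_wsqrtr.
apply: le_trans (cauchy_schwarz _ _) _.
by rewrite -sqdistE ler_piMr// sqdistE sqnorm_ge0.
Qed.

Lemma measurable_boundary_point (i : 'I_m.+1) :
  measurable_fun setT (fun y : Y => boundary_point y 0 i).
Proof.
under eq_fun do rewrite mxE.
by case: (unlift _ _) => [j|]; [exact: measurable_tnth|exact: measurable_cst].
Qed.

Lemma measurable_pairing x z : measurable_fun setT (pairing x z).
Proof.
apply: measurable_sum => i; apply: measurable_funM => //.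
under eq_fun do rewrite [_ 0 i]mxE [(- x) 0 i]mxE.
by apply: measurable_funB => //; exact: measurable_boundary_point.
Qed.

Lemma sqnorm_coord z i : z 0 i ^+ 2 <= sqnorm z.
Proof. by rewrite /sqnorm (bigD1 i)//= lerDl sumr_ge0// => j _; exact: sqr_ge0. Qed.

Lemma coord_le1 z i : sqnorm z <= 1 -> `|z 0 i| <= 1.
Proof.
move=> z1; rewrite -(@ler_pXn2r _ 2)// ?nnegrE// expr1n real_normK ?num_real//.
exact: le_trans (sqnorm_coord z i) z1.
Qed.

Lemma half_space_line x z (h : R) : half_space x -> sqnorm z <= 1 ->
  `|h| < x 0 ord_max / 2 -> x 0 ord_max / 2 <= (x + h *: z) 0 ord_max.
Proof.
move=> x0 z1 hd; rewrite !mxE.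
have : `|h * z 0 ord_max| <= `|h|.
  by rewrite normrM ler_piMr// coord_le1.
have := ler_norm (- (h * z 0 ord_max)); rewrite normrN.
by move: (x 0 ord_max) (h * _) `|h| hd => a b' c'; lra.
Qed.

Lemma sqrt_sqdist_ge x y : half_space x -> x 0 ord_max <= Num.sqrt (sqdist x y).
Proof.
move=> x0; rewrite -[leLHS](ger0_norm (ltW x0)) -sqrtr_sqr; apply: ler_wsqrtr.
by rewrite /sqdist lerDl sumr_ge0// => i _; exact: sqr_ge0.
Qed.

(** Moving [x] by less than half of its height keeps half of the height and
    of every distance to the boundary. *)
Lemma sqrt_sqdist_line x z (h : R) y : half_space x -> sqnorm z <= 1 ->
  `|h| < x 0 ord_max / 2 ->
  x 0 ord_max / 2 <= Num.sqrt (sqdist (x + h *: z) y) /\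
  Num.sqrt (sqdist x y) <= 2 * Num.sqrt (sqdist (x + h *: z) y).
Proof.
move=> x0 z1 hd; have xh := half_space_line x0 z1 hd.
have xh0 : half_space (x + h *: z).
  by apply: lt_le_trans xh; rewrite divr_gt0.
have sge := le_trans xh (sqrt_sqdist_ge y xh0); split => //.
have ple := pairing_le (x + h *: z) y z1.
have D0 : 0 <= sqdist (x + h *: z) y by exact/ltW/sqdist_gt0.
apply: (@le_trans _ _ (Num.sqrt (sqdist (x + h *: z) y) + `|h|)); last first.
  by move: sge hd; move: (Num.sqrt _) `|h| => s a; lra.
rewrite -[leRHS]ger0_norm ?addr_ge0 ?sqrtr_ge0// -sqrtr_sqr; apply: ler_wsqrtr.
rewrite sqrrD sqr_sqrtr// real_normK ?num_real//.
have -> : sqdist x y = sqdist (x + h *: z) y + pairing (x + h *: z) z y * h *+ 2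
    + sqnorm z * h ^+ 2.
  by rewrite sqdist_line pairing_line; ring.
apply: lerD; last by rewrite ler_piMl ?sqr_ge0.
rewrite lerD2l lerMn2r/=; apply: le_trans (ler_norm _) _.
by rewrite normrM ler_wpM2r.
Qed.
End geometry.

(** * Poisson-type integrals along a line *)

Section bounded.
Variables (R : realType) (m : nat).
Local Notation Y := (m.-tuple (measurableTypeR R)).
Local Notation lam := (lebesgue_tuple R m).
Implicit Types (x z : 'rV[R]_m.+1) (y : Y) (f : Y -> R).

Lemma Lfun_bounded f : f \in Lfun lam +oo%E ->
  [/\ measurable_fun setT f, 0 <= Linfty_norm f &
    {ae lam, forall y, `|f y| <= Linfty_norm f}].
Proof.
move=> /andP[]; rewrite !inE/= => mf finf.
have N0 : (0 <= 'N[lam]_+oo [EFin \o f])%E by exact: Lnorm_ge0.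
have Nfin : ('N[lam]_+oo [EFin \o f])%E = (Linfty_norm f)%:E.
  by rewrite /Linfty_norm fineK// ge0_fin_numE.
split.
- exact: mf.
- by rewrite fine_ge0.
have [muT|muT] := ltP 0%E (lam setT).
  have := Nfin; rewrite unlock /Lnorm muT => esupE.
  have := @ess_sup_ge _ _ _ lam (abse \o (EFin \o f)).
  by rewrite esupE; apply: filterS => y; rewrite /= lee_fin.
exists setT; split => //.
by apply/eqP; rewrite eq_le muT measure_ge0.
Qed.

(** The kernel itself is the integrable majorant. *)
Lemma integrable_sqdist_bounded x f (M : R) : (1 < m)%N -> half_space x ->
  measurable_fun setT f -> 0 <= M -> {ae lam, forall y, `|f y| <= M} ->
  lam.-integrable setT (EFin \o (fun y => `|f y| / Num.sqrt (sqdist x y) ^+ m.+1)).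
Proof.
move=> m1 x0 mf M0 fM.
have [g0 /(_ _ x0) mass] := @Gamma_half R m m1.
have msd : measurable_fun setT (fun y : Y => (Num.sqrt (sqdist x y) ^+ m.+1)^-1).
  exact: measurable_sqrt_sqdistX.
have mfs : measurable_fun setT (fun y => `|f y| / Num.sqrt (sqdist x y) ^+ m.+1).
  by apply: measurable_funM => //; exact: measurableT_comp.
apply/integrableP; split; first exact/measurable_EFinP.
apply: (@le_lt_trans _ _ (\int[lam]_y (M%:E * (Num.sqrt (sqdist x y) ^+ m.+1)^-1%:E))%E).
  apply: ae_ge0_le_integral => //.
  - exact/measurableT_comp/measurable_EFinP.
  - by move=> y _; rewrite -EFinM lee_fin mulr_ge0// invr_ge0 exprn_ge0.
  - by apply/measurable_EFinP; exact: measurable_funM.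
  apply: filterS fM => y fy _ /=; rewrite lee_fin normrM normr_id.
  rewrite (ger0_norm (_ : 0 <= (_ ^+ _)^-1)) ?invr_ge0 ?exprn_ge0//.
  by rewrite ler_wpM2r// invr_ge0 exprn_ge0.
rewrite ge0_integralZl; last 4 first.
- by [].
- exact/measurable_EFinP.
- by move=> y _; rewrite lee_fin invr_ge0 exprn_ge0.
- by rewrite lee_fin.
by rewrite mass -EFinM ltry.
Qed.

Lemma is_derive_line_kernel x z f (M : R) (g : Y -> R) (b A : R) (j : nat) :
  (1 < m)%N -> half_space x -> sqnorm z <= 1 ->
  measurable_fun setT f -> 0 <= M -> {ae lam, forall y, `|f y| <= M} ->
  measurable_fun setT g -> 0 <= A ->
  (forall y (h : R), `|h| < x 0 ord_max / 2 ->
    `|g y + b * h| <= A * Num.sqrt (sqdist (x + h *: z) y) ^+ j) ->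
  is_derive (0 : R) 1 (fun h => \int[lam]_y
    ((g y + b * h) / Num.sqrt (sqdist (x + h *: z) y) ^+ (m.+1 + j) * f y))
  (\int[lam]_y ((b / Num.sqrt (sqdist x y) ^+ (m.+1 + j) +
    (m.+1 + j)%:R * g y * pairing x z y /
      Num.sqrt (sqdist x y) ^+ (m.+1 + j).+2) * f y)) /\
  lam.-integrable setT (EFin \o (fun y =>
    (b / Num.sqrt (sqdist x y) ^+ (m.+1 + j) +
    (m.+1 + j)%:R * g y * pairing x z y /
      Num.sqrt (sqdist x y) ^+ (m.+1 + j).+2) * f y)).
Proof.
move=> m1 x0 z1 mf M0 fM mg A0 g_le.
have c0 : 0 < x 0 ord_max / 2 by rewrite divr_gt0.
have intf := integrable_sqdist_bounded m1 x0 mf M0 fM.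
have := @is_derive_integral_kernel _ Y R lam g (sqdist x) (pairing x z) f b
  (sqnorm z) A (x 0 ord_max / 2) (x 0 ord_max / 2) m.+1 j
  mg (measurable_sqdist x) (measurable_pairing x z) mf c0 c0 A0
  (fun y => sqdist_gt0 y x0).
have -> : (fun h : R => \int[lam]_y
    ((g y + b * h) / Num.sqrt (sqdist (x + h *: z) y) ^+ (m.+1 + j) * f y)) =
  (fun h => \int[lam]_y ((g y + b * h) / Num.sqrt (sqdist x y -
    2 * pairing x z y * h + sqnorm z * h ^+ 2) ^+ (m.+1 + j) * f y)).
  by apply/funext => h; apply: eq_Rintegral => y _; rewrite sqdist_line.
apply=> //.
- by move=> y h /(sqrt_sqdist_line y x0 z1)[+ _]; rewrite sqdist_line.
- by move=> y h /(sqrt_sqdist_line y x0 z1)[_]; rewrite sqdist_line.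
- by move=> y h; rewrite -pairing_line -sqdist_line pairing_le.
- by move=> y h /(g_le y); rewrite sqdist_line.
Qed.

Lemma is_derive_poisson_line x z f (M : R) : (1 < m)%N -> half_space x ->
  sqnorm z <= 1 ->
  measurable_fun setT f -> 0 <= M -> {ae lam, forall y, `|f y| <= M} ->
  is_derive (0 : R) 1 (fun h => \int[lam]_y
    ((x + h *: z) 0 ord_max / Num.sqrt (sqdist (x + h *: z) y) ^+ m.+1 * f y))
  (\int[lam]_y
    ((z 0 ord_max / Num.sqrt (sqdist x y) ^+ m.+1 +
      m.+1%:R * x 0 ord_max * pairing x z y / Num.sqrt (sqdist x y) ^+ m.+3) * f y)) /\
  lam.-integrable setT (EFin \o (fun y =>
    (z 0 ord_max / Num.sqrt (sqdist x y) ^+ m.+1 +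
      m.+1%:R * x 0 ord_max * pairing x z y / Num.sqrt (sqdist x y) ^+ m.+3) * f y)).
Proof.
move=> m1 x0 z1 mf M0 fM; have xn0 : 0 < x 0 ord_max by [].
have A0 : 0 <= 2 * x 0 ord_max by rewrite mulr_ge0// ltW.
have := @is_derive_line_kernel x z f M (cst (x 0 ord_max)) (z 0 ord_max)
  (2 * x 0 ord_max) 0 m1 x0 z1 mf M0 fM (measurable_cst _) A0.
rewrite addn0 => -[|dK iK].
  move=> y h hd; rewrite expr0 mulr1; apply: le_trans (ler_normD _ _) _.
  rewrite normrM (gtr0_norm xn0).
  have : `|z 0 ord_max| * `|h| <= `|h| by rewrite ler_piMl// coord_le1.
  by move: hd xn0; move: (x 0 ord_max) `|h| (_ * `|h|) => u v w; lra.
split=> //.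
rewrite (_ : (fun h : R => _) = (fun h => \int[lam]_y ((x 0 ord_max + z 0 ord_max * h) /
  Num.sqrt (sqdist (x + h *: z) y) ^+ m.+1 * f y))) //.
by apply/funext => h; apply: eq_Rintegral => y _; rewrite !mxE (mulrC h).
Qed.

End bounded.

(** * Moments of the Poisson kernel *)

Section moments.
Variables (R : realType) (m : nat).
Hypothesis m1 : (1 < m)%N.
Local Notation Y := (m.-tuple (measurableTypeR R)).
Local Notation lam := (lebesgue_tuple R m).
Local Notation n := (m.+1%:R : R).
Implicit Types (x z : 'rV[R]_m.+1) (y : Y) (f g : Y -> R).

(** [e_n^2], for [e] the unit vector from [x] towards [y]. *)
Definition normal_cos2 x y : R := x 0 ord_max ^+ 2 / sqdist x y.

(** [- e_n (e . z)], for [e] the unit vector from [x] towards [y]; the sign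
    comes from [e_n = - x_n / |y - x|]. *)
Definition cos_product x z y : R := x 0 ord_max * pairing x z y / sqdist x y.

Lemma measurable_sqdistV x : half_space x ->
  measurable_fun setT (fun y => (sqdist x y)^-1).
Proof.
move=> x0; apply: measurable_fun_inv_ge0 => [|y]; first exact: measurable_sqdist.
exact/ltW/sqdist_gt0.
Qed.

Lemma measurable_normal_cos2 x : half_space x -> measurable_fun setT (normal_cos2 x).
Proof. by move=> x0; apply: measurable_funM => //; exact: measurable_sqdistV. Qed.

Lemma measurable_cos_product x z : half_space x -> measurable_fun setT (cos_product x z).
Proof.
move=> x0; apply: measurable_funM; last exact: measurable_sqdistV.
by apply: measurable_funM => //; exact: measurable_pairing.
Qed.

Lemma integrable_kernelM x g (M : R) : half_space x ->
  measurable_fun setT g -> 0 <= M -> {ae lam, forall y, `|g y| <= M} ->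
  lam.-integrable setT (EFin \o (fun y => poisson_kernel x y * g y)).
Proof.
move=> x0 mg M0 gM.
have ig := integrable_sqdist_bounded m1 x0 mg M0 gM.
have := integrableZl measurableT (2 / sphere_area R m.+1 * x 0 ord_max) ig.
apply: le_integrable => //.
  by apply/measurable_EFinP; apply: measurable_funM => //; exact: measurable_poisson_kernel.
move=> y _ /=; rewrite lee_fin /poisson_kernel (mulrC `|g y|) !mulrA normrM.
by rewrite [leRHS]normrM normr_id.
Qed.

Lemma kernel_massR x : half_space x -> \int[lam]_y poisson_kernel x y = 1.
Proof. by move=> x0; rewrite /Rintegral poisson_kernel_mass. Qed.

Lemma is_derive_near_cst (F : R -> R) (e c l : R) : 0 < e ->
  (forall h, `|h| < e -> F h = c) -> is_derive (0 : R) 1 F l -> l = 0.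
Proof.
move=> e0 Fc [dF <-].
rewrite (@near_eq_derive _ _ _ F (cst c)) ?derive_cst ?oner_eq0//.
apply/nbhs_ballP; exists e => //= h; rewrite /ball/= sub0r normrN.
exact: Fc.
Qed.

(** The right-hand side is the derivative in direction [z] of the Poisson
    kernel, multiplied by the height. *)
Lemma cos_productE x z y : half_space x ->
  poisson_kernel x y * (z 0 ord_max + n * cos_product x z y) =
  2 / sphere_area R m.+1 * x 0 ord_max *
  (z 0 ord_max / Num.sqrt (sqdist x y) ^+ m.+1 +
      m.+1%:R * x 0 ord_max * pairing x z y / Num.sqrt (sqdist x y) ^+ m.+3).
Proof.
move=> x0; have q0 := sqdist_gt0 y x0.
have s0 : 0 < Num.sqrt (sqdist x y) by rewrite sqrtr_gt0.
rewrite /poisson_kernel /cos_product -{2}(sqr_sqrtr (ltW q0)) !exprS expr0.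
move: (sphere_area_gt0 R m1) => w0.
by field; rewrite expf_neq0 ?gt_eqF.
Qed.

Lemma cos_product_le1 x z y : half_space x -> sqnorm z <= 1 -> `|cos_product x z y| <= 1.
Proof.
move=> x0 z1; have q0 := sqdist_gt0 y x0.
have xn0 : 0 < x 0 ord_max by [].
rewrite /cos_product normrM normfV (gtr0_norm q0) ler_pdivrMr// mul1r normrM (gtr0_norm xn0).
rewrite -[leRHS](sqr_sqrtr (ltW q0)) expr2; apply: ler_pM; rewrite ?(ltW xn0)//.
  exact: sqrt_sqdist_ge.
exact: pairing_le.
Qed.

Lemma normal_cos2_ge0 x y : half_space x -> 0 <= normal_cos2 x y.
Proof. by move=> x0; rewrite divr_ge0 ?sqr_ge0// ltW// sqdist_gt0. Qed.

Lemma normal_cos2_le1 x y : half_space x -> normal_cos2 x y <= 1.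
Proof.
move=> x0; rewrite /normal_cos2 ler_pdivrMr ?sqdist_gt0// mul1r.
by rewrite lerDl sumr_ge0// => i _; exact: sqr_ge0.
Qed.

Lemma ae_bounded g (M : R) : (forall y, `|g y| <= M) -> {ae lam, forall y, `|g y| <= M}.
Proof. by move=> gM; exact: aeW. Qed.

Lemma integrable_kernel_cst x (c : R) : half_space x ->
  lam.-integrable setT (EFin \o (fun y => poisson_kernel x y * c)).
Proof.
by move=> x0; apply: (@integrable_kernelM _ _ `|c|) => //; exact: ae_bounded.
Qed.

Lemma integrable_kernel x : half_space x ->
  lam.-integrable setT (EFin \o poisson_kernel x).
Proof.
by move=> x0; have := integrable_kernel_cst 1 x0; under eq_fun do rewrite mulr1.
Qed.

Lemma integrable_kernel_cos_product x z : half_space x -> sqnorm z <= 1 ->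
  lam.-integrable setT (EFin \o (fun y => poisson_kernel x y * cos_product x z y)).
Proof.
move=> x0 z1; apply: (@integrable_kernelM _ _ 1) => //.
  exact: measurable_cos_product.
by apply: ae_bounded => y; exact: cos_product_le1.
Qed.

(** The mass of the kernel is the same at all points, so its derivative in
    direction [z], computed under the integral sign, vanishes. *)
Lemma Rintegral_cos_product x z : half_space x -> sqnorm z <= 1 ->
  \int[lam]_y (poisson_kernel x y * cos_product x z y) = - z 0 ord_max / n.
Proof.
move=> x0 z1; have xn0 : 0 < x 0 ord_max by [].
have w0 := sphere_area_gt0 R m1.
have c1 : {ae lam, forall y : Y, `|cst (1:R) y| <= 1}.
  by apply: ae_bounded => y; rewrite normr1.
have m1c : measurable_fun setT (cst 1 : Y -> R) by exact: measurable_cst.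
have [dF iF] := is_derive_poisson_line m1 x0 z1 m1c ler01 c1.
have mass h : `|h| < x 0 ord_max / 2 -> \int[lam]_y
    ((x + h *: z) 0 ord_max / Num.sqrt (sqdist (x + h *: z) y) ^+ m.+1 * cst 1 y) =
    sphere_area R m.+1 / 2.
  move=> hd; have xh0 : half_space (x + h *: z).
    by apply: lt_le_trans (half_space_line x0 z1 hd); rewrite divr_gt0.
  transitivity (sphere_area R m.+1 / 2 * \int[lam]_y poisson_kernel (x + h *: z) y).
    rewrite -RintegralZl//; last exact: integrable_kernel.
    apply: eq_Rintegral => y _; rewrite /= /poisson_kernel mulr1 [RHS]mulrA.
    by rewrite [X in _ = X * _](_ : _ = 1) ?mul1r//; field; rewrite gt_eqF.
  by rewrite kernel_massR// mulr1.
have c0 : 0 < x 0 ord_max / 2 by rewrite divr_gt0.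
have /(is_derive_near_cst c0 mass) V0 := dF.
have := congr1 (fun t => 2 / sphere_area R m.+1 * x 0 ord_max * t) V0.
rewrite mulr0 -RintegralZl//.
under eq_Rintegral do rewrite mulr1 -cos_productE// mulrDr mulrCA.
rewrite RintegralD//; last 2 first.
- exact: integrable_kernel_cst.
- exact: (integrableZl measurableT n (integrable_kernel_cos_product x0 z1)).
rewrite RintegralZr//; last exact: integrable_kernel.
rewrite kernel_massR// mul1r RintegralZl//; last exact: integrable_kernel_cos_product.
move=> /eqP; rewrite addr_eq0 => /eqP ->.
by rewrite opprK mulrC mulKf// pnatr_eq0.
Qed.

(** The case of [Rintegral_cos_product] where [z] is the downward normal. *)
Lemma Rintegral_normal_cos2 x : half_space x ->
  \int[lam]_y (poisson_kernel x y * normal_cos2 x y) = n^-1.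
Proof.
move=> x0; pose z : 'rV[R]_m.+1 := - delta_mx 0 ord_max.
have zE i : z 0 i = - (i == ord_max)%:R by rewrite !mxE eqxx.
have z1 : sqnorm z <= 1.
  rewrite /sqnorm (bigD1 ord_max)//= big1 ?zE ?eqxx ?sqrrN ?expr1n ?addr0//.
  by move=> i /negbTE ni; rewrite zE ni oppr0 expr0n.
have := Rintegral_cos_product x0 z1; rewrite zE eqxx opprK mul1r => <-.
apply: eq_Rintegral => y _; congr (_ * _); rewrite /cos_product /normal_cos2; congr (_ / _).
rewrite expr2; congr (_ * _).
rewrite /pairing (bigD1 ord_max)//= big1 ?addr0 => [|i /negbTE ni]; last first.
  by rewrite zE ni oppr0 mulr0.
by rewrite zE eqxx mulrN1 !mxE unlift_none sub0r opprK.
Qed.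

Lemma integrable_kernel_cos_product2 x z : half_space x -> sqnorm z <= 1 ->
  lam.-integrable setT (EFin \o (fun y => poisson_kernel x y * cos_product x z y ^+ 2)).
Proof.
move=> x0 z1; apply: (@integrable_kernelM _ _ 1) => //.
  by apply: measurable_funX; exact: measurable_cos_product.
by apply: ae_bounded => y; rewrite normrX expr_le1// cos_product_le1.
Qed.

Lemma integrable_kernel_cos2 x : half_space x ->
  lam.-integrable setT (EFin \o (fun y => poisson_kernel x y * normal_cos2 x y)).
Proof.
move=> x0; apply: (@integrable_kernelM _ _ 1) => //.
  exact: measurable_normal_cos2.
by apply: ae_bounded => y; rewrite ger0_norm ?normal_cos2_ge0// normal_cos2_le1.
Qed.

(** For tangential [z] the integral in [Rintegral_cos_product] is zero at every
    point of the line through [x] in direction [z]; differentiating it along that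
    line gives [(n + 2) int k (e_n (e . z))^2 = |z|^2 int k e_n^2]. *)
Lemma Rintegral_cos_product2 x z : half_space x -> sqnorm z <= 1 -> z 0 ord_max = 0 ->
  \int[lam]_y (poisson_kernel x y * cos_product x z y ^+ 2) =
  sqnorm z / (n * (n + 2)).
Proof.
move=> x0 z1 zn; have xn0 : 0 < x 0 ord_max by [].
have w0 := sphere_area_gt0 R m1.
have c0 : 0 < x 0 ord_max / 2 by rewrite divr_gt0.
have m1c : measurable_fun setT (cst 1 : Y -> R) by exact: measurable_cst.
have c1 : {ae lam, forall y : Y, `|cst (1:R) y| <= 1}.
  by apply: ae_bounded => y; rewrite normr1.
have A0 : 0 <= (x 0 ord_max / 2)^-1 by rewrite invr_ge0 ltW.
have [|dK iK] := @is_derive_line_kernel R m x z (cst 1) 1 (pairing x z) (- sqnorm z)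
  (x 0 ord_max / 2)^-1 2 m1 x0 z1 m1c ler01 c1 (measurable_pairing x z) A0.
  move=> y h hd; have [D_ge _] := sqrt_sqdist_line y x0 z1 hd.
  rewrite mulNr -pairing_line ler_pdivlMl// expr2.
  by apply: ler_pM => //; [exact: ltW|exact: pairing_le].
have K0 (h : R) : `|h| < x 0 ord_max / 2 -> \int[lam]_y
  ((pairing x z y + - sqnorm z * h) /
   Num.sqrt (sqdist (x + h *: z) y) ^+ (m.+1 + 2)
   * cst 1 y) = 0.
  move=> hd; have xh0 : half_space (x + h *: z).
    by apply: lt_le_trans (half_space_line x0 z1 hd); rewrite divr_gt0.
  have := Rintegral_cos_product xh0 z1; rewrite zn oppr0 mul0r => S0.
  pose t := sphere_area R m.+1 / 2 / x 0 ord_max ^+ 2.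
  rewrite -[RHS](mulr0 t) -S0 -RintegralZl//; last exact: integrable_kernel_cos_product.
  apply: eq_Rintegral => y _; rewrite /= mulr1 /cos_product /poisson_kernel.
  rewrite pairing_line !mxE zn mulr0 addr0 mulNr.
  have q0 := sqdist_gt0 y xh0.
  have s0 : 0 < Num.sqrt (sqdist (x + h *: z) y) by rewrite sqrtr_gt0.
  rewrite exprD -[X in _ / X = _](mulrC) (sqr_sqrtr (ltW q0)) /t.
  by field; rewrite expf_neq0 ?gt_eqF.
have /(is_derive_near_cst c0 K0) V0 := dK.
have := congr1 (fun t => 2 / sphere_area R m.+1 * x 0 ord_max ^+ 3 * t) V0.
rewrite mulr0 -RintegralZl// => V1.
have {}V1 : \int[lam]_y (- sqnorm z * (poisson_kernel x y * normal_cos2 x y) +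
   (n + 2) * (poisson_kernel x y * cos_product x z y ^+ 2)) = 0.
  rewrite -[RHS]V1; apply: eq_Rintegral => y _.
  rewrite /= mulr1 /cos_product /poisson_kernel /normal_cos2.
  have q0 := sqdist_gt0 y x0.
  have s0 : 0 < Num.sqrt (sqdist x y) by rewrite sqrtr_gt0.
  have e2 : Num.sqrt (sqdist x y) ^+ (m.+1 + 2) =
      Num.sqrt (sqdist x y) ^+ m.+1 * sqdist x y.
    by rewrite exprD (sqr_sqrtr (ltW q0)).
  have e4 : Num.sqrt (sqdist x y) ^+ (m.+1 + 2).+2 =
      Num.sqrt (sqdist x y) ^+ m.+1 * sqdist x y * sqdist x y.
    by rewrite -e2 -addn2 exprD (sqr_sqrtr (ltW q0)).
  rewrite e4 e2 natrD.
  by field; rewrite expf_neq0 ?gt_eqF.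
move: V1; rewrite RintegralD//; last 2 first.
- exact: (integrableZl measurableT (- sqnorm z) (integrable_kernel_cos2 x0)).
- exact: (integrableZl measurableT (n + 2) (integrable_kernel_cos_product2 x0 z1)).
rewrite RintegralZl//; last exact: integrable_kernel_cos_product2.
rewrite RintegralZl//; last exact: integrable_kernel_cos2.
rewrite Rintegral_normal_cos2//; move: (\int[lam]_y _) => I.
move=> IE; have n0 : 0 < n by rewrite ltr0n.
have -> : I = sqnorm z / n / (n + 2).
  apply: (mulfI (_ : n + 2 != 0)); first by rewrite gt_eqF// addr_gt0.
  rewrite mulrCA mulfV ?mulr1; last by rewrite gt_eqF// addr_gt0.
  by move/eqP: IE; rewrite addrC mulNr subr_eq0 => /eqP.
by rewrite invfM mulrA.
Qed.
End moments.

(** * The sharp mean inequality *)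

Section mean_bound.
Variables (R : realType) (m : nat).
Hypothesis m1 : (1 < m)%N.
Local Notation Y := (m.-tuple (measurableTypeR R)).
Local Notation lam := (lebesgue_tuple R m).
Local Notation n := (m.+1%:R : R).
Implicit Types (x z : 'rV[R]_m.+1) (y : Y) (f g : Y -> R).

Lemma pairing_linear x y (b : R) z w :
  pairing x (b *: z + w) y = b * pairing x z y + pairing x w y.
Proof.
rewrite /pairing mulr_sumr -big_split/=; apply: eq_bigr => i _.
by rewrite !mxE; ring.
Qed.

Lemma cos_product_linear x y (b : R) z w :
  cos_product x (b *: z + w) y = b * cos_product x z y + cos_product x w y.
Proof. by rewrite /cos_product pairing_linear; ring. Qed.

Lemma pairing_normal x y : pairing x (delta_mx 0 ord_max) y = - x 0 ord_max.
Proof.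
rewrite /pairing (bigD1 ord_max)//= big1 ?addr0 => [|i /negbTE ni].
  by rewrite !mxE unlift_none !eqxx mulr1 sub0r.
by rewrite !mxE ni andbF mulr0.
Qed.

Lemma cos_product_normal x y : cos_product x (delta_mx 0 ord_max) y = - normal_cos2 x y.
Proof. by rewrite /cos_product pairing_normal /normal_cos2 mulrN mulNr expr2. Qed.

Definition tangential z : 'rV[R]_m.+1 := z - z 0 ord_max *: delta_mx 0 ord_max.

Lemma tangential_normal z : tangential z 0 ord_max = 0.
Proof. by rewrite !mxE !eqxx mulr1 subrr. Qed.

Lemma tangential_neq z i : i != ord_max -> tangential z 0 i = z 0 i.
Proof. by move=> /negbTE ni; rewrite !mxE ni andbF mulr0 subr0. Qed.

Lemma sqnorm_tangential z : sqnorm (tangential z) = sqnorm z - z 0 ord_max ^+ 2.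
Proof.
rewrite /sqnorm !(bigD1_ord ord_max)//= [_ + _ - _]addrAC subrr add0r.
rewrite tangential_normal expr0n add0r; apply: eq_bigr => i _.
by rewrite tangential_neq// eq_sym neq_lift.
Qed.

Lemma cos_product_decomp x z y :
  cos_product x z y = cos_product x (tangential z) y - z 0 ord_max * normal_cos2 x y.
Proof.
rewrite -{1}[z](subrK (z 0 ord_max *: delta_mx 0 ord_max)) addrC cos_product_linear.
by rewrite cos_product_normal mulrN addrC.
Qed.

(** Only the tangential part of [e] meets [z], so the left-hand side is at
    most [s |e_n| sqrt (1 - e_n^2)] with [s = |z|], by Cauchy-Schwarz. *)
Lemma cos_product_tangential_le x z y : half_space x -> z 0 ord_max = 0 ->
  `|cos_product x z y| <= Num.sqrt (sqnorm z) / 2.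
Proof.
move=> x0 z0; have q0 := sqdist_gt0 y x0.
have := cauchy_schwarz (tangential (boundary_point y - x)) z.
have -> : \sum_i tangential (boundary_point y - x) 0 i * z 0 i = pairing x z y.
  apply: eq_bigr => i _; have [->|ni] := eqVneq i ord_max.
    by rewrite z0 !mulr0.
  by rewrite tangential_neq.
rewrite sqnorm_tangential -sqdistE.
have -> : (boundary_point y - x) 0 ord_max = - x 0 ord_max.
  by rewrite !mxE unlift_none sub0r.
rewrite sqrrN => H.
rewrite -(@ler_pXn2r _ 2)// ?nnegrE ?divr_ge0 ?sqrtr_ge0//.
rewrite real_normK ?num_real// [in leRHS]expr_div_n sqr_sqrtr ?sqnorm_ge0//.
rewrite /cos_product expr_div_n ler_pdivrMr ?exprn_gt0// exprMn.
apply: le_trans (ler_wpM2l (sqr_ge0 _) H) _.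
(* [4 X (q - X) <= q ^ 2] for [X = x_n ^ 2] and [q = sqdist x y]. *)
have := sqr_ge0 (sqdist x y - 2 * x 0 ord_max ^+ 2).
have := sqnorm_ge0 z.
move: (sqdist x y) (x 0 ord_max ^+ 2) (sqnorm z) => q a s s0 qa.
have := mulr_ge0 s0 qa; lra.
Qed.

(** With [th = 2 t c / s < 1], one has [th |B| <= t c <= c A], so
    [|c A + th B| = c A + th B]; the rest [(1 - th) |B|] is bounded by
    the arithmetic-geometric mean inequality with weight [k].  A majorant that is
    quadratic in [B] can be integrated from the first two moments alone. *)
Lemma norm_majorant (c s t A B k : R) : 0 <= c -> 0 < t -> t <= A -> `|B| <= s / 2 ->
  0 < k -> 2 * t * c < s ->
  `|c * A + B| <= c * A + (1 - 2 * t * c / s) * ((k * B ^+ 2 / s + s / k) / 2)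
     + 2 * t * c / s * B.
Proof.
move=> c0 t0 tA Bs k0 cs.
have s0 : 0 < s by apply: le_lt_trans cs; rewrite !mulr_ge0// ltW.
set th := 2 * t * c / s.
have th0 : 0 <= th by rewrite /th divr_ge0 ?mulr_ge0 // ltW.
have th1 : th < 1 by rewrite /th ltr_pdivrMr// mul1r.
have cA : t * c <= c * A by rewrite mulrC ler_wpM2l.
have thB : th * `|B| <= c * A.
  apply: le_trans cA; rewrite /th mulrAC ler_pdivrMr//.
  have := ler_wpM2l (mulr_ge0 (ltW t0) c0) Bs; lra.
have BA : `|B| <= (k * B ^+ 2 / s + s / k) / 2.
  have : 0 <= (k * `|B| - s) ^+ 2 / (k * s).
    by rewrite divr_ge0 ?sqr_ge0// mulr_ge0// ltW.
  rewrite (_ : _ / (k * s) = k * `|B| ^+ 2 / s + s / k - 2 * `|B|); last first.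
    by field; rewrite !gt_eqF.
  by rewrite real_normK ?num_real//; lra.
apply: (@le_trans _ _ (c * A + (1 - th) * `|B| + th * B)); last first.
  by rewrite lerD2r lerD2l ler_wpM2l// subr_ge0 ltW.
have cA0 : 0 <= c * A by rewrite mulr_ge0// (le_trans (ltW t0)).
case: (lerP 0 B) => B0.
  by rewrite ger0_norm ?addr_ge0// ?(ger0_norm B0); lra.
rewrite (ltr0_norm B0) in thB *.
by rewrite ler_norml; apply/andP; split; nra.
Qed.

(** After squaring, the claim follows from
    [s^2 <= 1 - c^2 <= 4 (1 - c)] and from
    [4 (1 - c) = 4 (1 - c)^2 + 4 c (1 - c)
      <= N^2 (1 - c)^2 + 4 t N c (1 - c)]. *)
Lemma cap_inequality (c s t N : R) : 0 <= c -> 0 <= s -> c ^+ 2 + s ^+ 2 <= 1 ->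
  0 < t -> 2 <= N -> 1 <= t * N -> c * N + s - 2 * t * c <= N.
Proof.
move=> c0 s0 cs t0 N2 tN.
have c1 : c <= 1 by nra.
suff : s <= N * (1 - c) + 2 * t * c by lra.
have r0 : 0 <= N * (1 - c) + 2 * t * c.
  by rewrite addr_ge0// ?mulr_ge0 ?subr_ge0//; lra.
rewrite -(@ler_pXn2r _ 2)// ?nnegrE//.
apply: (@le_trans _ _ (4 * (1 - c))).
  by nra.
have h1 : 4 * (1 - c) ^+ 2 <= N ^+ 2 * (1 - c) ^+ 2.
  by rewrite ler_wpM2r ?sqr_ge0//; nra.
have h2 : 4 * (c * (1 - c)) <= 4 * (t * N) * (c * (1 - c)).
  by rewrite ler_wpM2r ?mulr_ge0 ?subr_ge0//; lra.
have h3 : 0 <= (t * c) ^+ 2 by exact: sqr_ge0.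
nra.
Qed.

Lemma cos_productN x z y : cos_product x (- z) y = - cos_product x z y.
Proof.
have -> : - z = - 1 *: z + 0 by rewrite scaleN1r addr0.
rewrite cos_product_linear (_ : cos_product x 0 y = 0) ?addr0 ?mulN1r//.
rewrite /cos_product /pairing big1 ?mulr0 ?mul0r// => i _.
by rewrite [X in _ * X]mxE mulr0.
Qed.

Lemma integrable_kernel_weight x z (alpha : R) : half_space x -> sqnorm z <= 1 ->
  lam.-integrable setT (EFin \o (fun y =>
    poisson_kernel x y * `|alpha * z 0 ord_max + cos_product x z y|)).
Proof.
move=> x0 z1; apply: (@integrable_kernelM _ _ m1 _ _ (`|alpha * z 0 ord_max| + 1)) => //.
  apply: measurableT_comp => //; apply: measurable_funD => //.
  exact: measurable_cos_product.
apply: ae_bounded => y; rewrite normr_id; apply: le_trans (ler_normD _ _) _.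
by rewrite lerD2l cos_product_le1.
Qed.

Lemma Rintegral_majorant x z (k0 k1 k2 k3 : R) : half_space x -> sqnorm z <= 1 ->
  z 0 ord_max = 0 ->
  lam.-integrable setT (EFin \o (fun y => poisson_kernel x y *
    (k0 + k1 * normal_cos2 x y + k2 * cos_product x z y + k3 * cos_product x z y ^+ 2))) /\
  \int[lam]_y (poisson_kernel x y *
    (k0 + k1 * normal_cos2 x y + k2 * cos_product x z y + k3 * cos_product x z y ^+ 2)) =
  k0 + k1 / n + k3 * (sqnorm z / (n * (n + 2))).
Proof.
move=> x0 z1 zn.
have i0 := integrable_kernel_cst m1 k0 x0.
have i1 := integrableZl measurableT k1 (integrable_kernel_cos2 m1 x0).
have i2 := integrableZl measurableT k2 (integrable_kernel_cos_product m1 x0 z1).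
have i3 := integrableZl measurableT k3 (integrable_kernel_cos_product2 m1 x0 z1).
have i01 := integrableD measurableT i0 i1.
have i012 := integrableD measurableT i01 i2.
have i0123 := integrableD measurableT i012 i3.
have E y : poisson_kernel x y *
    (k0 + k1 * normal_cos2 x y + k2 * cos_product x z y + k3 * cos_product x z y ^+ 2) =
  poisson_kernel x y * k0 + k1 * (poisson_kernel x y * normal_cos2 x y) +
  k2 * (poisson_kernel x y * cos_product x z y) +
  k3 * (poisson_kernel x y * cos_product x z y ^+ 2).
  by ring.
split.
  by under eq_fun do rewrite E; exact: i0123.
under eq_Rintegral do rewrite E.
rewrite (RintegralD measurableT i012 i3) (RintegralD measurableT i01 i2).
rewrite (RintegralD measurableT i0 i1).
rewrite (RintegralZl k1 measurableT (integrable_kernel_cos2 m1 x0)).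
rewrite (RintegralZl k2 measurableT (integrable_kernel_cos_product m1 x0 z1)).
rewrite (RintegralZl k3 measurableT (integrable_kernel_cos_product2 m1 x0 z1)).
rewrite (RintegralZr k0 measurableT (integrable_kernel m1 x0)).
rewrite (kernel_massR m1 x0) Rintegral_normal_cos2// Rintegral_cos_product2//.
by rewrite (Rintegral_cos_product m1 x0 z1) zn oppr0 mul0r mulr0 addr0 mul1r.
Qed.

(** The inequality behind the theorem.  Equality holds when [z] is the unit
    normal, since [alpha > 1 >= e_n^2] makes the weight positive. *)
Lemma mean_weight_le x z (alpha : R) : half_space x -> sqnorm z <= 1 ->
  1 < alpha -> 1 <= (alpha - 1) * (n * alpha - 1) ->
  \int[lam]_y (poisson_kernel x y * `|alpha * z 0 ord_max + cos_product x z y|) <=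
  alpha - n^-1.
Proof.
move=> x0 + a1 tN.
(* The integrand is even in [z]. *)
wlog c0 : z / 0 <= z 0 ord_max.
  move=> H z1; case: (lerP 0 (z 0 ord_max)) => [|c0]; first by move=> c0; exact: H.
  have := H (- z); rewrite !mxE oppr_ge0 => /(_ (ltW c0)).
  rewrite {1}/sqnorm; under eq_bigr do rewrite mxE sqrrN.
  move=> /(_ z1); apply: le_trans; rewrite le_eqVlt; apply/orP; left; apply/eqP.
  by apply: eq_Rintegral => y _; rewrite mulrN cos_productN -opprD normrN.
move=> z1; set c := z 0 ord_max in c0 *.
set w := tangential z; have wn : w 0 ord_max = 0 by exact: tangential_normal.
have wE : sqnorm w = sqnorm z - c ^+ 2 by exact: sqnorm_tangential.
have w1 : sqnorm w <= 1.
  by rewrite wE (le_trans _ z1)// lerBlDr lerDl sqr_ge0.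
set s := Num.sqrt (sqnorm w); set t := alpha - 1 in tN *; set N := n * alpha - 1 in tN *.
have s0 : 0 <= s by exact: sqrtr_ge0.
have s2 : s ^+ 2 = sqnorm w by rewrite sqr_sqrtr ?sqnorm_ge0.
have t0 : 0 < t by rewrite subr_gt0.
have n3 : 3 <= n by rewrite ler_nat.
have n0 : 0 < n by rewrite ltr0n.
have N2 : 2 <= N by rewrite /N; nra.
have cs : c ^+ 2 + s ^+ 2 <= 1 by rewrite s2 wE; lra.
have aE : alpha - n^-1 = N / n by rewrite /N; field; rewrite gt_eqF.
have cap := cap_inequality c0 s0 cs t0 N2 tN.
have At y : t <= alpha - normal_cos2 x y by rewrite /t lerD2l lerN2 normal_cos2_le1.
have Bs y : `|cos_product x w y| <= s / 2 by exact: cos_product_tangential_le.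
have zE y : alpha * c + cos_product x z y = c * (alpha - normal_cos2 x y) + cos_product x w y.
  by rewrite cos_product_decomp -/c -/w; ring.
(* The two cases differ in whether the sign of [c A] absorbs all of [B]. *)
have [[[k0 k1] [k2 k3]] maj kle] : exists2 k : (R * R) * (R * R),
    forall y, `|alpha * c + cos_product x z y| <= k.1.1 + k.1.2 * normal_cos2 x y +
      k.2.1 * cos_product x w y + k.2.2 * cos_product x w y ^+ 2 &
    k.1.1 + k.1.2 / n + k.2.2 * (sqnorm w / (n * (n + 2))) <= N / n.
  case: (lerP s (2 * t * c)) => st.
    exists ((c * alpha, - c), (1, 0)) => [y|] /=.
      rewrite zE ger0_norm; first by rewrite le_eqVlt; apply/orP; left; apply/eqP; ring.
      have := ler_norm (- cos_product x w y); rewrite normrN; have := Bs y.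
      have := ler_wpM2l c0 (At y); lra.
    rewrite mul0r addr0 mulNr -mulrBr aE ler_piMl//.
      by rewrite divr_ge0// ltW//; lra.
    by nra.
  have sp : 0 < s by apply: le_lt_trans st; rewrite !mulr_ge0// ltW.
  pose th := 1 - 2 * t * c / s.
  have th0 : 0 <= th by rewrite subr_ge0 ler_pdivrMr// mul1r ltW.
  exists ((c * alpha + th * (s / n) / 2, - c), (2 * t * c / s, th * (n / s) / 2))
    => [y|] /=.
    rewrite zE; apply: le_trans (norm_majorant c0 t0 (At y) (Bs y) n0 st) _.
    by rewrite -/th le_eqVlt; apply/orP; left; apply/eqP; ring.
  rewrite -s2.
  have -> : c * alpha + th * (s / n) / 2 + - c / n +
      th * (n / s) / 2 * (s ^+ 2 / (n * (n + 2))) =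
      c * (N / n) + th * ((s / n + s / (n + 2)) / 2).
    by rewrite -aE; field; rewrite !gt_eqF// addr_gt0.
  have sn : s / (n + 2) <= s / n.
    by rewrite ler_pM2l// lef_pV2 ?posrE ?addr_gt0// lerDl.
  apply: (@le_trans _ _ (c * (N / n) + th * (s / n))).
    rewrite lerD2l ler_wpM2l//.
    by move: sn; move: (s / n) (s / (n + 2)) => u v; lra.
  rewrite [leLHS](_ : _ = (c * N + s - 2 * t * c) / n); last first.
    by rewrite /th; field; rewrite !gt_eqF.
  by rewrite ler_pM2r// invr_gt0.
have [iM iE] := Rintegral_majorant k0 k1 k2 k3 x0 w1 wn.
rewrite aE; apply: le_trans kle; rewrite -iE.
apply: le_Rintegral => //; first exact: integrable_kernel_weight.
by move=> y _; rewrite ler_wpM2l// ltW// poisson_kernel_gt0.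
Qed.
End mean_bound.

(** * The gradient as an integral *)

Lemma derive_along_line (R : realType) (V : normedModType R) (F : V -> R) (x v : V) (l : R) :
  is_derive (0 : R) 1 (fun h => F (x + h *: v)) l -> 'D_v F x = l.
Proof.
move=> [_ <-].
have E : (fun h : R => h^-1 *: ((F \o shift x) (h *: v) - F x)) =
    (fun h : R => h^-1 *: (((fun t => F (x + t *: v)) \o shift 0) (h *: (1 : R)) -
      (fun t => F (x + t *: v)) 0)).
  by apply/funext => h /=; rewrite scale0r !addr0 [h *: 1]mulr1 [x + _]addrC.
by rewrite /derive E.
Qed.

Lemma Rintegral_sum d (T : measurableType d) (R : realType)
    (mu : {measure set T -> \bar R}) (I : Type) (s : seq I) (F : I -> T -> R) :
  (forall i, mu.-integrable setT (EFin \o F i)) ->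
  mu.-integrable setT (EFin \o (fun t => \sum_(i <- s) F i t)) /\
  \int[mu]_t (\sum_(i <- s) F i t) = \sum_(i <- s) \int[mu]_t F i t.
Proof.
move=> iF; elim: s => [|i s [IHi IHs]].
  have -> : (fun t : T => \sum_(i <- [::]) F i t) = cst 0.
    by apply/funext => t; rewrite big_nil.
  split; first exact: integrable0.
  by rewrite big_nil /Rintegral integral0.
have -> : (fun t => \sum_(j <- i :: s) F j t) =
    (fun t => F i t + \sum_(j <- s) F j t).
  by apply/funext => t; rewrite big_cons.
split; first exact: (integrableD measurableT (iF i) IHi).
by rewrite (RintegralD measurableT (iF i) IHi) IHs big_cons.
Qed.

Section gradient_formula.
Variables (R : realType) (m : nat).
Hypothesis m1 : (1 < m)%N.
Local Notation Y := (m.-tuple (measurableTypeR R)).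
Local Notation lam := (lebesgue_tuple R m).
Local Notation n := (m.+1%:R : R).
Implicit Types (x z : 'rV[R]_m.+1) (y : Y) (f g : Y -> R).

Lemma integrable_kernelMf x g f (C M : R) : half_space x ->
  measurable_fun setT g -> (forall y, `|g y| <= C) ->
  measurable_fun setT f -> 0 <= M -> {ae lam, forall y, `|f y| <= M} ->
  lam.-integrable setT (EFin \o (fun y => poisson_kernel x y * (g y * f y))).
Proof.
move=> x0 mg gC mf M0 fM.
have C0 : 0 <= C by apply: le_trans (gC point).
apply: (@integrable_kernelM _ _ m1 _ _ (C * M)) => //.
- exact: measurable_funM.
- exact: mulr_ge0.
by apply: filterS fM => y fy; rewrite normrM ler_pM.
Qed.

Lemma sqnorm_delta (i : 'I_m.+1) : sqnorm (delta_mx 0 i : 'rV[R]_m.+1) = 1.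
Proof.
rewrite /sqnorm (bigD1 i)//= big1 ?addr0 => [|j /negbTE ji].
  by rewrite mxE !eqxx expr1n.
by rewrite mxE ji andbF expr0n.
Qed.

Lemma pairing_delta x y i :
  pairing x (delta_mx 0 i) y = (boundary_point y - x) 0 i.
Proof.
rewrite /pairing (bigD1 i)//= big1 ?addr0 => [|j /negbTE ji].
  by rewrite [X in _ * X]mxE !eqxx mulr1.
by rewrite [X in _ * X]mxE ji andbF mulr0.
Qed.

Lemma cos_product_sum x z y :
  cos_product x z y = \sum_i z 0 i * cos_product x (delta_mx 0 i) y.
Proof.
rewrite /cos_product [in LHS]/pairing mulr_sumr mulr_suml; apply: eq_bigr => i _.
by rewrite pairing_delta; ring.
Qed.

Lemma near_half_space_line x (v : 'rV[R]_m.+1) : half_space x ->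
  \forall h \near (0 : R), half_space (x + h *: v).
Proof.
move=> x0.
pose F (h : R) := x 0 ord_max + h * v 0 ord_max.
have cF : F h @[h --> (0 : R)] --> F 0.
  apply: cvgD; first exact: cvg_cst.
  by apply: cvgMl; exact: cvg_id.
have F0 : 0 < F 0 by rewrite /F mul0r addr0.
near=> h; rewrite /half_space/= !mxE.
by near: h; exact: (cvgr_gt _ cF _ F0).
Unshelve. end_near.
Qed.

(** Differentiating the power of the height gives [n a - 1] times the kernel,
    differentiating the numerator [x_n] of the kernel gives it once more; hence
    the coefficient [n a] of the normal component. *)
Lemma partial_weighted a u f x (i : 'I_m.+1) : hardy_infty u f -> half_space x ->
  partial i (weighted a u) x = x 0 ord_max `^ (n * a - 2) * (n *
    (a * (delta_mx 0 i : 'rV[R]_m.+1) 0 ord_max * \int[lam]_y (poisson_kernel x y * f y) +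
     \int[lam]_y (poisson_kernel x y * (cos_product x (delta_mx 0 i) y * f y)))).
Proof.
move=> [_ fL uE] x0; have [mf M0 fM] := Lfun_bounded fL.
set v : 'rV[R]_m.+1 := delta_mx 0 i.
have v1 : sqnorm v <= 1 by rewrite sqnorm_delta.
have xn0 : 0 < x 0 ord_max by [].
have w0 := sphere_area_gt0 R m1.
have [dI iI] := is_derive_poisson_line m1 x0 v1 mf M0 fM.
set I := (fun h : R => \int[lam]_y _) in dI; set V := (\int[lam]_y _) in dI.
have ik : lam.-integrable setT (EFin \o (fun y => poisson_kernel x y * f y)).
  exact: integrable_kernelM fM.
have iks : lam.-integrable setT
    (EFin \o (fun y => poisson_kernel x y * (cos_product x v y * f y))).
  apply: (@integrable_kernelMf _ _ _ 1) fM => //; first exact: measurable_cos_product.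
  by move=> y; exact: cos_product_le1.
set J0 := (\int[lam]_y (poisson_kernel x y * f y)).
set JS := (\int[lam]_y _).
have I0 : I 0 = sphere_area R m.+1 / 2 * J0.
  rewrite -(RintegralZl _ measurableT ik) /I; apply: eq_Rintegral => y _.
  rewrite scale0r addr0 /poisson_kernel !mulrA.
  by rewrite [X in _ = X * _ / _ * _](_ : _ = 1) ?mul1r//; field; rewrite gt_eqF.
have VE : V = sphere_area R m.+1 / 2 / x 0 ord_max * (v 0 ord_max * J0 + n * JS).
  rewrite -(RintegralZl _ measurableT ik) -(RintegralZl _ measurableT iks).
  rewrite -(RintegralD measurableT (integrableZl measurableT _ ik)
    (integrableZl measurableT _ iks)).
  rewrite -(RintegralZl _ measurableT (integrableD measurableT
    (integrableZl measurableT _ ik) (integrableZl measurableT _ iks))).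
  apply: eq_Rintegral => y _.
  have q0 := sqdist_gt0 y x0.
  have := cos_productE m1 v y x0; rewrite -/(cos_product x v y).
  set S := (_ / _ + _ / _) => SE.
  transitivity (sphere_area R m.+1 / 2 / x 0 ord_max *
    (2 / sphere_area R m.+1 * x 0 ord_max * S) * f y).
    by rewrite /S; field; rewrite ?expf_neq0 ?gt_eqF ?sqrtr_gt0.
  by rewrite -SE; ring.
have dP : is_derive (0 : R) 1 (fun h => (x 0 ord_max + h * v 0 ord_max) `^ (n * a - 1))
    ((n * a - 1) * x 0 ord_max `^ (n * a - 1 - 1) * v 0 ord_max).
  have dl : is_derive (0 : R) 1 (fun h => x 0 ord_max + h * v 0 ord_max) (v 0 ord_max).
    by apply: is_derive_eq; rewrite /GRing.scale/=; ring.
  have dp : is_derive (x 0 ord_max + 0 * v 0 ord_max) 1 (fun t => t `^ (n * a - 1))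
      ((n * a - 1) * x 0 ord_max `^ (n * a - 1 - 1)).
    by rewrite mul0r addr0; exact: is_derive1_powR.
  exact: (@is_derive1_comp R (fun t => t `^ (n * a - 1))
    (fun h => x 0 ord_max + h * v 0 ord_max) 0 _ _ dp dl).
apply: derive_along_line.
pose G (h : R) := (x 0 ord_max + h * v 0 ord_max) `^ (n * a - 1) *
    (2 / sphere_area R m.+1 * I h).
have GE : \forall h \near (0 : R), G h = weighted a u (x + h *: v).
  near=> h; have xh0 : half_space (x + h *: v).
    by near: h; exact: near_half_space_line.
  have xhE : (x + h *: v) 0 ord_max = x 0 ord_max + h * v 0 ord_max.
    by rewrite 2!mxE.
  by rewrite /weighted (uE _ xh0) poissonE /G -xhE.
apply: (near_eq_is_derive GE).
apply: (is_derive_eq (is_deriveM dP (is_deriveZ _ dI))).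
rewrite {1 2}/GRing.scale/= mul0r addr0 I0 VE -/v [_ *: _]mulrC.
have -> : n * a - 1 - 1 = n * a - 2 by ring.
have -> : x 0 ord_max `^ (n * a - 1) = x 0 ord_max `^ (n * a - 2) * x 0 ord_max.
  rewrite -[X in _ = _ * X](powRr1 (ltW xn0)) -powRD; last first.
    by rewrite (gt_eqF xn0) implybT.
  by congr (_ `^ _); ring.
rewrite /GRing.scale/=; field; rewrite !gt_eqF.
Unshelve. all: by end_near. Qed.

End gradient_formula.

(** * The equation of the critical exponent *)

Section alpha_root.
Variables (R : realType) (n : nat).
Hypothesis n3 : (3 <= n)%N.

Let n3R : 3 <= n%:R :> R. Proof. by rewrite ler_nat. Qed.

Let sqrt_ge1 (t : R) : 1 <= Num.sqrt (1 + t ^+ 2).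
Proof. by rewrite -[leLHS]sqrtr1 ler_wsqrtr// lerDl sqr_ge0. Qed.

Let factor_gt0 (a : R) : 1 < a -> 0 < n%:R * a - 1.
Proof. by move=> a1; have := n3R; move: (n%:R) => k k3; nra. Qed.

Lemma alpha_rootP (a : R) : 1 < a -> alpha_root n a <->
  (a - 1) * (pi * (n%:R * a - 1)) = 2 * (1 + Num.sqrt (1 + (a - 1) ^+ 2)).
Proof.
move=> a1; have N0 : 0 < pi * (n%:R * a - 1) :> R.
  by rewrite mulr_gt0 ?pi_gt0 ?factor_gt0.
have D0 : 0 < 1 + Num.sqrt (1 + (a - 1) ^+ 2).
  by rewrite ltr_pwDl.
have E := eqr_div 2 (a - 1) (lt0r_neq0 N0) (lt0r_neq0 D0).
rewrite /alpha_root; split=> [[_ /eqP]|H].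
  by rewrite E => /eqP <-.
by split=> //; apply/eqP; rewrite E H.
Qed.

(** At [1] the cleared difference is [- 4]; at [7 / 3], where the square root is
    the rational [5 / 3], it is positive. *)
Lemma alpha_root_exists : exists a : R, alpha_root n a.
Proof.
pose F (a : R) : R :=
  (a - 1) * (pi * (n%:R * a - 1)) - 2 * (1 + Num.sqrt (1 + (a - 1) ^+ 2)).
have cF : continuous F.
  move=> a; apply: cvgB.
    apply: cvgM; first by apply: cvgB; [exact: cvg_id|exact: cvg_cst].
    apply: cvgMr; apply: cvgB; last exact: cvg_cst.
    by apply: cvgMr; exact: cvg_id.
  apply: cvgMr; apply: cvgD; first exact: cvg_cst.
  apply: continuous_comp; last exact: sqrt_continuous.
  apply: cvgD; first exact: cvg_cst.
  by apply: cvgM; apply: cvgB; (exact: cvg_id || exact: cvg_cst).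
pose b : R := 7 / 3.
have b1 : 1 <= b by rewrite /b; lra.
have F1 : F 1 < 0.
  rewrite /F subrr mul0r expr0n addr0 sqrtr1; lra.
have Fb : 0 < F b.
  have -> : F b = 4 / 3 * (pi * (n%:R * (7 / 3) - 1)) - 2 * (1 + 5 / 3).
    rewrite /F /b (_ : 7 / 3 - 1 = 4 / 3); last by field.
    rewrite (_ : 1 + (4 / 3) ^+ 2 = (5 / 3) ^+ 2); last by field.
    by rewrite sqrtr_sqr ger0_norm.
  have p2 := pi_ge2 R; have : 6 <= n%:R * (7 / 3) - 1 :> R by have := n3R; lra.
  move: pi (_ - 1) p2 => p N p2 N6.
  have : 12 <= p * N by nra.
  lra.
have F0b : Num.min (F 1) (F b) <= 0 <= Num.max (F 1) (F b).
  by rewrite ge_min (ltW F1) le_max (ltW Fb) orbT.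
have [c] := IVT b1 (continuous_subspaceT cF) F0b.
rewrite in_itv/= => /andP[c1 _] Fc; exists c.
have c1' : 1 < c.
  by rewrite lt_neqAle c1 andbT; apply: contraTneq F1 => ->; rewrite Fc ltxx.
by apply/alpha_rootP => //; apply/eqP; rewrite -subr_eq0; apply/eqP.
Qed.

(** With [t = a - 1] the cleared equation says that [pi (n a - 1)] equals
    [2 (1 / t + sqrt (1 / t^2 + 1))]; the former increases with [a], the latter
    decreases. *)
Lemma alpha_root_inj (a b : R) : alpha_root n a -> alpha_root n b -> a < b -> False.
Proof.
move=> ra rb ab; have [a1 _] := ra; have [b1 _] := rb.
move/(alpha_rootP a1): ra => ra; move/(alpha_rootP b1): rb => rb.
have p0 := pi_gt0 R.
set s := a - 1 in ra; set t := b - 1 in rb.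
have s0 : 0 < s by rewrite subr_gt0.
have t0 : 0 < t by rewrite subr_gt0.
have st : s < t by rewrite ltrD2r.
have H : s * Num.sqrt (1 + t ^+ 2) <= t * Num.sqrt (1 + s ^+ 2).
  have h1 : 0 <= s * Num.sqrt (1 + t ^+ 2) by rewrite mulr_ge0 ?sqrtr_ge0 ?ltW.
  have h2 : 0 <= t * Num.sqrt (1 + s ^+ 2) by rewrite mulr_ge0 ?sqrtr_ge0 ?ltW.
  rewrite -(ger0_norm h1) -(ger0_norm h2) -!sqrtr_sqr; apply: ler_wsqrtr.
  rewrite !exprMn !sqr_sqrtr ?addr_ge0 ?sqr_ge0//.
  have : s ^+ 2 <= t ^+ 2 by apply: lerXn2r; rewrite ?nnegrE ltW.
  by move: (s ^+ 2) (t ^+ 2) => u v; lra.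
have Nab : n%:R * a - 1 < n%:R * b - 1 by rewrite ltrD2r ltr_pM2l//; have := n3R; lra.
have pN : pi * (n%:R * a - 1) < pi * (n%:R * b - 1) by rewrite ltr_pM2l.
have st0 : 0 < s * t by rewrite mulr_gt0.
have := ltr_pM2l st0 (pi * (n%:R * a - 1)) (pi * (n%:R * b - 1)).
rewrite pN.
have -> : s * t * (pi * (n%:R * a - 1)) = t * (s * (pi * (n%:R * a - 1))) by ring.
have -> : s * t * (pi * (n%:R * b - 1)) = s * (t * (pi * (n%:R * b - 1))) by ring.
rewrite ra rb => K.
move: H K; rewrite !mulrDr !mulr1 !(mulrCA _ 2); lra.
Qed.

Lemma alpha_root_unique : exists! a : R, alpha_root n a.
Proof.
have [a ra] := alpha_root_exists; exists a; split => // b rb.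
have [ab|ba|//] := ltgtP a b.
  by case: (alpha_root_inj ra rb ab).
by case: (alpha_root_inj rb ra ba).
Qed.

(** The only property of the root that the estimate needs: the right-hand side
    of the equation is at most [(alpha_n - 1) / 2], so that
    [(alpha_n - 1) (n alpha_n - 1) >= 4 / pi >= 1], and the product increases
    with [alpha]. *)
Lemma alpha_root_le (a0 a : R) : alpha_root n a0 -> a0 <= a ->
  1 < a /\ 1 <= (a - 1) * (n%:R * a - 1).
Proof.
move=> ra a0a; have [a01 _] := ra; split; first exact: lt_le_trans a0a.
move/(alpha_rootP a01): ra => ra.
have p4 : pi < 4 :> R by have := pihalf_lt2 R; lra.
have N0 := factor_gt0 a01.
have H : 4 <= (a0 - 1) * (pi * (n%:R * a0 - 1)).
  by rewrite ra; have := sqrt_ge1 (a0 - 1); lra.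
have H1 : 1 <= (a0 - 1) * (n%:R * a0 - 1).
  have : 0 < (a0 - 1) * (n%:R * a0 - 1) by apply: mulr_gt0 => //; rewrite subr_gt0.
  move: H; rewrite mulrCA; move: (_ * (n%:R * a0 - 1)) => u; nra.
apply: le_trans H1 _; apply: ler_pM.
- by rewrite subr_ge0 ltW.
- exact: ltW.
- by rewrite lerD2r.
- by rewrite lerD2r ler_wpM2l.
Qed.

End alpha_root.

(** * Sharpness of the gradient bound *)

Section sharpness.
Variables (R : realType) (m : nat).
Hypothesis m1 : (1 < m)%N.
Local Notation Y := (m.-tuple (measurableTypeR R)).
Local Notation lam := (lebesgue_tuple R m).
Local Notation n := (m.+1%:R : R).
Implicit Types (x z : 'rV[R]_m.+1) (y : Y) (f g : Y -> R).

Lemma normr_Rintegral_le f g M : lam.-integrable setT (EFin \o f) ->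
  lam.-integrable setT (EFin \o g) -> 0 <= M -> (forall y, 0 <= g y) ->
  {ae lam, forall y, `|f y| <= M * g y} ->
  `|\int[lam]_y f y| <= M * \int[lam]_y g y.
Proof.
move=> iF iG M0 g0 fg.
apply: le_trans (le_normr_Rintegral measurableT iF) _.
have iMG := integrableZl measurableT M iG.
rewrite -(RintegralZl M measurableT iG).
have iNF : lam.-integrable setT (EFin \o (fun y => `|f y|)).
  exact: integrable_abse iF.
apply: fine_le.
- exact: (integrable_fin_num measurableT iNF).
- exact: (integrable_fin_num measurableT iMG).
apply: ae_ge0_le_integral => //.
- exact: (measurable_int _ iNF).
- by move=> y _; rewrite lee_fin mulr_ge0.
- exact: (measurable_int _ iMG).
by apply: filterS fg => y fy _; rewrite lee_fin.
Qed.

(** Pairing the gradient with the unit vector [z] in its own direction turns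
    its length into one integral against [f], to which [mean_weight_le]
    applies. *)
Lemma gradient_bound_weighted (a : R) x : 1 < a -> 1 <= (a - 1) * (n * a - 1) ->
  half_space x ->
  gradient_bound a x ((n * a - 1) * x 0 ord_max `^ (n * a - 2)).
Proof.
move=> a1 tN x0 u f huf; have [_ fL _] := huf; have [mf M0 fM] := Lfun_bounded fL.
set X := x 0 ord_max `^ (n * a - 2).
have X0 : 0 <= X by exact: powR_ge0.
have n0 : 0 < n by rewrite ltr0n.
set grad := gradient (weighted a u) x.
have N0 : 0 <= n * a - 1.
  have : 0 < (a - 1) * (n * a - 1) by exact: lt_le_trans tN.
  by rewrite pmulr_rgt0 ?subr_gt0// => /ltW; rewrite subr_ge0.
have [G0|G0] := eqVneq (enorm grad) 0.
  by rewrite G0 !mulr_ge0.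
have Gp : 0 < enorm grad by rewrite lt_neqAle eq_sym G0 sqrtr_ge0.
pose z := (enorm grad)^-1 *: grad.
have G2 : enorm grad ^+ 2 = sqnorm grad by rewrite enormE sqr_sqrtr// sqnorm_ge0.
have z1 : sqnorm z = 1.
  rewrite /sqnorm (eq_bigr (fun i => (enorm grad)^-1 ^+ 2 * grad 0 i ^+ 2)).
    by rewrite -mulr_sumr -/(sqnorm grad) -G2 -exprMn mulVf// expr1n.
  by move=> i _; rewrite mxE exprMn.
have z1' : sqnorm z <= 1 by rewrite z1.
have zG : \sum_i z 0 i * grad 0 i = enorm grad.
  rewrite (eq_bigr (fun i => (enorm grad)^-1 * grad 0 i ^+ 2)).
    by rewrite -mulr_sumr -/(sqnorm grad) -G2 expr2 mulKf.
  by move=> i _; rewrite mxE -mulrA -expr2.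
pose J0 := \int[lam]_y (poisson_kernel x y * f y).
pose JS v := \int[lam]_y (poisson_kernel x y * (cos_product x v y * f y)).
have gradE i : grad 0 i = X * (n *
    (a * (delta_mx 0 i : 'rV[R]_m.+1) 0 ord_max * J0 + JS (delta_mx 0 i))).
  by rewrite mxE (partial_weighted m1 a i huf x0).
have ik : lam.-integrable setT (EFin \o (fun y => poisson_kernel x y * f y)).
  exact: integrable_kernelM fM.
have iks v : sqnorm v <= 1 -> lam.-integrable setT
    (EFin \o (fun y => poisson_kernel x y * (cos_product x v y * f y))).
  move=> v1; apply: (@integrable_kernelMf _ _ m1 _ _ _ 1) fM => //.
    exact: measurable_cos_product.
  by move=> y; exact: cos_product_le1.
have hd (i : 'I_m.+1) : sqnorm (delta_mx 0 i : 'rV[R]_m.+1) <= 1.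
  by rewrite sqnorm_delta.
have JSz : \sum_i z 0 i * JS (delta_mx 0 i) = JS z.
  have iF (i : 'I_m.+1) : lam.-integrable setT (EFin \o (fun y =>
      z 0 i * (poisson_kernel x y * (cos_product x (delta_mx 0 i) y * f y)))).
    exact: (integrableZl measurableT (z 0 i) (iks _ (hd i))).
  have [_ S] := Rintegral_sum (index_enum _) iF.
  transitivity (\sum_i \int[lam]_y
      (z 0 i * (poisson_kernel x y * (cos_product x (delta_mx 0 i) y * f y)))).
    by apply: eq_bigr => i _; rewrite (RintegralZl _ measurableT (iks _ (hd i))).
  rewrite -S; apply: eq_Rintegral => y _.
  rewrite (cos_product_sum x z) mulr_suml mulr_sumr; apply: eq_bigr => i _; ring.
have zn : \sum_i z 0 i * (delta_mx 0 i : 'rV[R]_m.+1) 0 ord_max = z 0 ord_max.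
  rewrite (bigD1 ord_max)//= big1 ?addr0 => [|i /negbTE ni].
    by rewrite [X in _ * X]mxE !eqxx mulr1.
  by rewrite [X in _ * X]mxE eq_sym ni andbF mulr0.
have iw : lam.-integrable setT (EFin \o (fun y =>
    poisson_kernel x y * ((a * z 0 ord_max + cos_product x z y) * f y))).
  apply: (@integrable_kernelMf _ _ m1 _ _ _ (`|a * z 0 ord_max| + 1)) fM => //.
    by apply: measurable_funD => //; exact: measurable_cos_product.
  move=> y; apply: le_trans (ler_normD _ _) _.
  by rewrite lerD2l cos_product_le1// z1.
have GE : enorm grad = X * (n * \int[lam]_y
    (poisson_kernel x y * ((a * z 0 ord_max + cos_product x z y) * f y))).
  transitivity (X * (n * (a * z 0 ord_max * J0 + JS z))).
    rewrite -zG -JSz -[in RHS]zn.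
    rewrite mulr_sumr mulr_suml -big_split/= !mulr_sumr.
    by apply: eq_bigr => i _; rewrite gradE; ring.
    rewrite /J0 /JS -(RintegralZl _ measurableT ik).
  rewrite -(RintegralD measurableT (integrableZl measurableT _ ik) (iks _ z1')).
  by congr (_ * (_ * _)); apply: eq_Rintegral => y _; ring.
have mean := mean_weight_le m1 x0 z1' a1 tN.
rewrite GE.
have H := normr_Rintegral_le iw (integrable_kernel_weight m1 a x0 z1') M0.
have {}H :
    `|\int[lam]_y (poisson_kernel x y * ((a * z 0 ord_max + cos_product x z y) * f y))| <=
    Linfty_norm f *
    \int[lam]_y (poisson_kernel x y * `|a * z 0 ord_max + cos_product x z y|).
  apply: H.
    by move=> y; rewrite mulr_ge0// ltW// poisson_kernel_gt0.
  apply: filterS fM => y fy.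
  have k0 := poisson_kernel_gt0 y m1 x0.
  rewrite normrM (gtr0_norm k0) [leRHS]mulrCA normrM ler_wpM2l ?(ltW k0)//.
  by rewrite mulrC ler_wpM2r.
rewrite (mulrC _ X) -!mulrA ler_wpM2l//.
rewrite (_ : n * a - 1 = n * (a - n^-1)); last by rewrite mulrBr mulfV ?gt_eqF.
rewrite -mulrA ler_wpM2l ?(ltW n0)//.
apply: le_trans (ler_norm _) _; apply: le_trans H _.
by rewrite mulrC ler_wpM2r.
Qed.

Lemma lebesgue_tuple_setT_gt0 : (0 < lam setT)%E.
Proof.
rewrite lt_neqAle measure_ge0 andbT; apply/eqP => /esym lam0.
have x0 : half_space (const_mx 1 : 'rV[R]_m.+1) by rewrite /half_space/= mxE.
have := poisson_kernel_mass m1 x0; rewrite null_set_integral//.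
- by move=> /eqP; rewrite eq_sym onee_eq0.
- by apply/measurable_EFinP; exact: measurable_poisson_kernel.
Qed.

Lemma Lnorm_cst1 : ('N[lam]_+oo [EFin \o (cst 1%R : Y -> R)])%E = 1%E.
Proof.
rewrite unlock /Lnorm lebesgue_tuple_setT_gt0.
rewrite (_ : abse \o _ = cst 1%E); first by rewrite ess_sup_cst// lebesgue_tuple_setT_gt0.
by apply/funext => y /=; rewrite normr1.
Qed.

Lemma Linfty_norm_cst1 : Linfty_norm (cst 1 : Y -> R) = 1.
Proof. by rewrite /Linfty_norm Lnorm_cst1. Qed.

(** At the constant [1] the gradient bound is attained, whatever the point. *)
Lemma hardy_infty_cst1 : hardy_infty (cst 1 : 'rV[R]_m.+1 -> R) (cst 1).
Proof.
have p0 i : partial i (cst 1 : 'rV[R]_m.+1 -> R) = cst 0.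
  by apply/funext => x; rewrite /partial derive_cst.
have p00 i : partial i (cst 0 : 'rV[R]_m.+1 -> R) = cst 0.
  by apply/funext => x; rewrite /partial derive_cst.
split.
- split.
  + by move=> x _; exact: cst_continuous.
  + by move=> x i _; split; [exact: derivable_cst|rewrite p0; exact: cst_continuous].
  + move=> x i j _; rewrite p0 p00.
    by split; [exact: derivable_cst|exact: cst_continuous].
  + by move=> x _; rewrite big1// => i _; rewrite p0 p00.
- apply/andP; split; rewrite inE/=; first exact: measurable_cst.
  by rewrite /finite_norm Lnorm_cst1 ltry.
move=> x x0; rewrite poissonE.
transitivity (\int[lam]_y poisson_kernel x y); first by rewrite kernel_massR.
rewrite -RintegralZl//; first by apply: eq_Rintegral => y _; rewrite mulr1.
have := integrableZl measurableT (sphere_area R m.+1 / 2) (integrable_kernel m1 x0).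
have w0 := sphere_area_gt0 R m1.
congr (_.-integrable _ _); apply/funext => y /=.
rewrite -EFinM /poisson_kernel mulr1; congr EFin.
by rewrite mulrA [X in X * _](_ : _ = 1) ?mul1r//; field; rewrite gt_eqF.
Qed.

Lemma partial_weighted_cst1 (a : R) x (i : 'I_m.+1) : half_space x ->
  partial i (weighted a (cst 1)) x =
  (i == ord_max)%:R * ((n * a - 1) * x 0 ord_max `^ (n * a - 2)).
Proof.
move=> x0; rewrite (partial_weighted m1 a i hardy_infty_cst1 x0).
have -> : \int[lam]_y (poisson_kernel x y * cst 1 y) = 1.
  by rewrite -[RHS](kernel_massR m1 x0); apply: eq_Rintegral => y _; rewrite mulr1.
have -> : \int[lam]_y (poisson_kernel x y * (cos_product x (delta_mx 0 i) y * cst 1 y)) =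
    - (delta_mx 0 i : 'rV[R]_m.+1) 0 ord_max / n.
  rewrite -(Rintegral_cos_product m1 x0) ?sqnorm_delta//.
  by apply: eq_Rintegral => y _; rewrite mulr1.
rewrite mxE eqxx/= eq_sym; move: (i == ord_max)%:R (_ `^ _) => d X.
by field; rewrite nat1r pnatr_eq0.
Qed.

Lemma enorm_gradient_cst1 (a : R) x : half_space x -> 0 <= n * a - 1 ->
  enorm (gradient (weighted a (cst 1)) x) = (n * a - 1) * x 0 ord_max `^ (n * a - 2).
Proof.
move=> x0 N0; have V0 : 0 <= (n * a - 1) * x 0 ord_max `^ (n * a - 2).
  by rewrite mulr_ge0// powR_ge0.
rewrite -[RHS](ger0_norm V0) -sqrtr_sqr; congr Num.sqrt.
rewrite (bigD1 ord_max)//= big1 ?addr0 => [|i /negbTE ni].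
  by rewrite mxE partial_weighted_cst1// eqxx mul1r.
by rewrite mxE partial_weighted_cst1// ni mul0r expr0n.
Qed.

Lemma partial_le_gradient (u : 'rV[R]_m.+1 -> R) x i :
  `|partial i u x| <= enorm (gradient u x).
Proof.
rewrite -sqrtr_sqr; apply: ler_wsqrtr.
by have := sqnorm_coord (gradient u x) i; rewrite mxE.
Qed.

End sharpness.

Unset Implicit Arguments.

Theorem corollary4 (R : realType) (m : nat) (n_ge3 : (3 <= m.+1)%N) :
  (exists! alpha_n : R, alpha_root m.+1 alpha_n) /\
  forall (alpha_n alpha : R) (x : 'rV[R]_m.+1),
    alpha_root m.+1 alpha_n -> alpha_n <= alpha -> half_space x ->
    sharp_coefficient alpha x
      ((m.+1%:R * alpha - 1) * x 0 ord_max `^ (m.+1%:R * alpha - 2)) /\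
    sup_normal alpha x = sup_gradient alpha x.
Proof.
split; first exact: alpha_root_unique.
move=> alpha_n alpha x ra le_alpha x0.
have [a1 tN] := alpha_root_le n_ge3 ra le_alpha.
have m1 : (1 < m)%N by [].
have bound := gradient_bound_weighted m1 a1 tN x0.
have h1 := @hardy_infty_cst1 R m m1.
have L1 := @Linfty_norm_cst1 R m m1.
have N0 : 0 <= m.+1%:R * alpha - 1.
  have : 0 < (alpha - 1) * (m.+1%:R * alpha - 1) by exact: lt_le_trans tN.
  by rewrite pmulr_rgt0 ?subr_gt0// => /ltW; rewrite subr_ge0.
have G1 := enorm_gradient_cst1 m1 x0 N0.
set C := (m.+1%:R * alpha - 1) * _ in bound G1 *.
have C0 : 0 <= C by rewrite mulr_ge0// powR_ge0.
split.
  split=> // C' /(_ _ _ h1); rewrite L1 mulr1; apply: le_trans.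
  by rewrite -G1.
apply/eqP; rewrite eq_le; apply/andP; split.
  apply: ge_ereal_sup => _ [u [f [huf f1 ->]]].
  apply: le_trans (_ : _ <= (enorm (gradient (weighted alpha u) x))%:E)%E _.
    by rewrite lee_fin partial_le_gradient.
  by apply: ereal_sup_ubound; exists u, f.
apply: (@le_trans _ _ C%:E).
  apply: ge_ereal_sup => _ [u [f [huf f1 ->]]].
  by rewrite lee_fin (le_trans (bound _ _ huf))// ler_piMr.
apply: ereal_sup_ubound; exists (cst 1), (cst 1); split => //.
  by rewrite L1.
by rewrite partial_weighted_cst1// eqxx mul1r ger0_norm.
Qed.
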